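(* Assume $\mu_n\subset K$, let $z\in V_n(K)$ and let $\gamma$ be a path on $V_n\otimes\overline K$ from $\overrightarrow{01}$ to $z$. Let $\tilde\chi_k^{z^n}$ be the polylogarithmic characters along $\pi_n(\gamma):\overrightarrow{01}\rightsquigarrow z^n$ and, for $s=0,\dots,n-1$, $\tilde\chi_d^{\zeta_n^sz}$ those along $\delta_{\zeta_n^s}\jmath_{\zeta_n^s}(\gamma):\overrightarrow{01}\rightsquigarrow\zeta_n^sz$. Then for every $k\ge1$ and $\sigma\in G_K$, $$\tilde\chi_k^{z^n}(\sigma)=\sum_{d=1}^k\binom{k-1}{d-1}n^{d-1}\sum_{s=0}^{n-1}(s\chi(\sigma))^{k-d}\,\tilde\chi_d^{\zeta_n^sz}(\sigma),$$ with the convention $0^0=1$.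
   Context: $K\subset\mathbb C$ subfield, $\overline K\subset\mathbb C$ its algebraic closure, $G_K=\mathrm{Gal}(\overline K/K)$, $\ell$ a prime, $\chi:G_K\to\mathbb Z_\ell^\times$ the $\ell$-adic cyclotomic character, $\mu_n$ the $n$-th roots of unity, $\zeta_N=e^{2\pi i/N}$. $V_n=\mathbf P^1\setminus(\{0,\infty\}\cup\mu_n)$, $V_1=\mathbf P^1\setminus\{0,1,\infty\}$, each with tangential base point $\overrightarrow{01}$ (unit tangent vector at $0$); for $\zeta\in\mu_n$, $\zeta\overrightarrow{01}$ is the tangent vector $\zeta$ at $0$. Paths are pro-$\ell$ étale paths, composed left to right. $\pi_n:V_n\to V_1$, $z\mapsto z^n$ (sending $\overrightarrow{01}$ to a base point identified with $\overrightarrow{01}$), and $\jmath_\zeta:V_n\to V_1$, $z\mapsto\zeta z$, so $\jmath_\zeta(\gamma)$ runs from $\zeta\overrightarrow{01}$ to $\zeta z$. For $\zeta=\zeta_n^s$ ($0\le s\le n-1$), $\delta_\zeta$ is the anticlockwise arc (of angle $2\pi s/n$) from $\overrightarrow{01}$ to $\zeta\overrightarrow{01}$ on $V_1$. For a $K$-point $w$ of $V_1$ and a path $p$ from $\overrightarrow{01}$ to $w$: $p$ determines, by continuation from the standard branches at $\overrightarrow{01}$ (where $t^{1/\ell^m}$ is positive on small positive reals and roots of $1-\zeta^at^{1/\ell^m}$ tend to $1$), compatible roots $w^{1/\ell^m}$ and $(1-\zeta_{\ell^m}^\alpha w^{1/\ell^m})^{1/\ell^m}$; the Kummer character $\rho_w:G_K\to\mathbb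 Z_\ell$ satisfies $\sigma(w^{1/\ell^m})=\zeta_{\ell^m}^{\rho_w(\sigma)}w^{1/\ell^m}$; the $\ell$-adic polylogarithmic characters $\tilde\chi_k^{w}=\tilde\chi_k^{w,p}:G_K\to\mathbb Z_\ell$ ($k\ge1$) are characterized by $$\zeta_{\ell^m}^{\tilde\chi_k^w(\sigma)}=\sigma\Bigl(\prod_{a=0}^{\ell^m-1}(1-\zeta_{\ell^m}^{\chi(\sigma)^{-1}a}w^{1/\ell^m})^{\frac{a^{k-1}}{\ell^m}}\Bigr)\Big/\prod_{a=0}^{\ell^m-1}(1-\zeta_{\ell^m}^{a+\rho_w(\sigma)}w^{1/\ell^m})^{\frac{a^{k-1}}{\ell^m}}$$ for all $m\ge1$, the fractional powers being taken with the roots determined by $p$. (In particular $\tilde\chi_1^w=\rho_{1-w}$.) *)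

(* Defs.v *)
From HB Require Import structures.
From mathcomp Require Import all_boot all_order all_algebra all_fingroup all_solvable.
From mathcomp Require Import complex.
From mathcomp Require Import all_classical all_reals all_analysis.
Set Implicit Arguments.
Unset Strict Implicit.
Unset Printing Implicit Defensive.
Import Order.TTheory GRing.Theory Num.Theory.
Import numFieldNormedType.Exports.
Local Open Scope ring_scope.
Local Open Scope classical_set_scope.

(* The ring Z_l of l-adic integers, as the inverse limit of the rings Z/l^m:  *)
(* [x m] is the representative of x mod l^m in {0, ..., l^m - 1}.             *)
Section PadicInt.
Variable l : nat.

Definition padic_compat (x : nat -> int) :=
  `[< forall m, x m = (x m.+1 %% (l ^ m)%:Z)%Z >].

Record padic_int := PadicInt { pres :> nat -> int; _ : padic_compat pres }.

HB.instance Definition _ := [isSub for pres].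
HB.instance Definition _ := gen_eqMixin padic_int.
HB.instance Definition _ := gen_choiceMixin padic_int.

Lemma pres_compat (x : padic_int) m : x m = (x m.+1 %% (l ^ m)%:Z)%Z.
Proof. by case: x => x /= /asboolP. Qed.

Lemma pres_mod (x : padic_int) m : (x m %% (l ^ m)%:Z)%Z = x m.
Proof. by rewrite pres_compat modz_mod. Qed.

Lemma padic_eqP (x y : padic_int) : (forall m, x m = y m) -> x = y.
Proof. by move=> xy; apply/val_inj/funext. Qed.

Lemma mod_modX (a : int) m : ((a %% (l ^ m.+1)%:Z)%Z %% (l ^ m)%:Z)%Z = (a %% (l ^ m)%:Z)%Z.
Proof.
by rewrite [in RHS](divz_eq a (l ^ m.+1)%:Z) expnS PoszM mulrA modzMDl.
Qed.

Fact padic_of_subproof (f : nat -> int) :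
  (forall m, (f m = f m.+1 %[mod (l ^ m)%:Z])%Z) ->
  padic_compat (fun m => (f m %% (l ^ m)%:Z)%Z).
Proof. by move=> Hf; apply/asboolP => m; rewrite mod_modX Hf. Qed.

Definition padic_of f Hf := PadicInt (@padic_of_subproof f Hf).

Fact pres_modS (x : padic_int) m : (x m = x m.+1 %[mod (l ^ m)%:Z])%Z.
Proof. by rewrite [x m]pres_compat modz_mod. Qed.

Fact padd_subproof (x y : padic_int) m :
  (x m + y m = x m.+1 + y m.+1 %[mod (l ^ m)%:Z])%Z.
Proof. by rewrite -modzDm !(pres_modS _ m) modzDm. Qed.

Fact pmul_subproof (x y : padic_int) m :
  (x m * y m = x m.+1 * y m.+1 %[mod (l ^ m)%:Z])%Z.
Proof. by rewrite -modzMm !(pres_modS _ m) modzMm. Qed.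

Fact popp_subproof (x : padic_int) m :
  (- x m = - x m.+1 %[mod (l ^ m)%:Z])%Z.
Proof. by rewrite -modzNm (pres_modS _ m) modzNm. Qed.

Definition padic_int_of (a : int) := padic_of (fun m => erefl (a %% (l ^ m)%:Z)%Z).
Definition padd x y := padic_of (padd_subproof x y).
Definition pmul x y := padic_of (pmul_subproof x y).
Definition popp x := padic_of (popp_subproof x).

Fact paddA : associative padd.
Proof. by move=> x y z; apply: padic_eqP => m /=; rewrite modzDmr modzDml addrA. Qed.
Fact paddC : commutative padd.
Proof. by move=> x y; apply: padic_eqP => m /=; rewrite addrC. Qed.
Fact padd0 : left_id (padic_int_of 0) padd.
Proof. by move=> x; apply: padic_eqP => m /=; rewrite modzDml add0r pres_mod. Qed.
Fact paddN : left_inverse (padic_int_of 0) popp padd.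
Proof. by move=> x; apply: padic_eqP => m /=; rewrite modzDml addNr. Qed.
HB.instance Definition _ := GRing.isZmodule.Build padic_int paddA paddC padd0 paddN.

Fact pmulA : associative pmul.
Proof. by move=> x y z; apply: padic_eqP => m /=; rewrite modzMmr modzMml mulrA. Qed.
Fact pmulC : commutative pmul.
Proof. by move=> x y; apply: padic_eqP => m /=; rewrite mulrC. Qed.
Fact pmul1 : left_id (padic_int_of 1) pmul.
Proof. by move=> x; apply: padic_eqP => m /=; rewrite modzMml mul1r pres_mod. Qed.
Fact pmulDl : left_distributive pmul +%R.
Proof.
by move=> x y z; apply: padic_eqP => m /=; rewrite modzMml modzDml modzDmr mulrDl.
Qed.
HB.instance Definition _ :=
  GRing.Zmodule_isComPzRing.Build padic_int pmulA pmulC pmul1 pmulDl.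

Record padic_unit := PadicUnit {
  punit :> padic_int;
  pinv : padic_int;
  _ : punit * pinv = 1 }.

End PadicInt.

Section AlgebraicClosure.
Variables (R : realType) (K : divringClosed R[i]).

Definition algebraic_over : pred R[i] := fun x =>
  `[< exists2 p : {poly R[i]}, p \is a polyOver K & p != 0 /\ root p x >].

Record subK := SubK { subK_val : R[i]; _ : subK_val \in K }.
HB.instance Definition _ := [isSub for subK_val].
HB.instance Definition _ := [Choice of subK by <:].
HB.instance Definition _ := [SubChoice_isSubIntegralDomain of subK by <:].
HB.instance Definition _ := [SubIntegralDomain_isSubField of subK by <:].

Lemma algebraic_overP x :
  x \in algebraic_over <-> algebraicOver (val : subK -> R[i]) x.
Proof.
split=> [/asboolP[p /polyOverP pK [p0 rx]]|[q q0 rx]].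
  pose q : {poly subK} := \poly_(i < size p) SubK (pK i).
  have qp : map_poly val q = p.
    apply/polyP => i; rewrite coef_map /= coef_poly; case: ltnP => //= h.
    by rewrite nth_default.
  by exists q; rewrite ?qp // -(map_poly_eq0 (val : {rmorphism subK -> R[i]})) qp.
apply/asboolP; exists (map_poly val q).
  by apply/polyOverP => i; rewrite coef_map /=; case: (q`_i).
by rewrite (map_poly_eq0 (val : {rmorphism subK -> R[i]})).
Qed.

Fact algebraic_over_divring : divring_closed algebraic_over.
Proof.
split; first by apply/algebraic_overP; apply: algebraic1.
- move=> x y /algebraic_overP hx /algebraic_overP hy.
  by apply/algebraic_overP; apply: algebraic_sub.
- move=> x y /algebraic_overP hx /algebraic_overP hy.
  by apply/algebraic_overP; apply: algebraic_div.
Qed.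
HB.instance Definition _ :=
  GRing.isDivringClosed.Build R[i] algebraic_over algebraic_over_divring.

Record Kbar := MkKbar { kval :> R[i]; _ : kval \in algebraic_over }.
HB.instance Definition _ := [isSub for kval].
HB.instance Definition _ := [Choice of Kbar by <:].
HB.instance Definition _ := [SubChoice_isSubIntegralDomain of Kbar by <:].
HB.instance Definition _ := [SubIntegralDomain_isSubField of Kbar by <:].

Record galois_aut := GaloisAut {
  gal_fun :> {rmorphism Kbar -> Kbar};
  gal_bij : bijective gal_fun;
  gal_fix : forall x : Kbar, kval x \in K -> gal_fun x = x }.

End AlgebraicClosure.

Section RootsOfUnity.
Variable R : realType.
Local Open Scope complex_scope.

Definition expi (theta : R) : R[i] := cos theta +i* sin theta.

Definition zeta (N : nat) : R[i] := expi (2 * pi / N%:R).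

Lemma expiX theta k : expi theta ^+ k = expi (theta *+ k).
Proof.
elim: k => [|k IHk]; first by rewrite expr0 mulr0n /expi cos0 sin0.
by rewrite exprSr IHk mulrSr /expi cosD sinD [sin _ * _ + _]addrC.
Qed.

Lemma zeta_unity N : (0 < N)%N -> zeta N ^+ N = 1.
Proof.
move=> N0; have N0' : N%:R != 0 :> R by rewrite pnatr_eq0 -lt0n.
by rewrite expiX -(mulr_natr (_ / _)) divfK // mulr_natl /expi cos2pi sin2pi.
Qed.

Fact zeta_algebraic (K : divringClosed R[i]) N : zeta N \in algebraic_over K.
Proof.
case: N => [|N]; first by rewrite /zeta /expi invr0 mulr0 cos0 sin0 rpred1.
apply/asboolP; exists ('X^(N.+1) - 1).
  by rewrite rpredB ?rpredX ?polyOverX // -[1]polyC1 polyOverC rpred1.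
by rewrite -size_poly_eq0 size_XnsubC //= rootE hornerD hornerN hornerC hornerXn zeta_unity ?subrr.
Qed.

Definition zetaK (K : divringClosed R[i]) N : Kbar K :=
  MkKbar (zeta_algebraic K N).

End RootsOfUnity.

(* An algebra over the coordinate ring Kbar[t, 1/t, 1/(1 - t^n)] of V_n is a  *)
(* Kbar-algebra B with a distinguished t : B such that t and 1 - t^n are      *)
(* units; this is how finite covers of V_n (x) Kbar are encoded below.        *)
Section Covers.
Variables (R : realType) (K : divringClosed R[i]) (l : nat).
Local Notation Kb := (Kbar K).

Section Algebras.
Variables (n : nat) (B : comAlgType Kb) (t : B).

Definition alg_over_V := exists u, u * (t * (1 - t ^+ n)) = 1.

Definition module_finite := exists s : seq B, forall b : B,
  exists (N : nat) (P : 'I_(size s) -> {poly Kb}),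
    (t * (1 - t ^+ n)) ^+ N * b = \sum_i horner_alg t (P i) * s`_i.

(* Unique lifting of morphisms over V_n along square-zero extensions C -> D.  *)
(* C is an algebra over V_n via t |-> c: t being a unit with 1 - t^n a unit   *)
(* in D, so are c and 1 - c^n in C.                                           *)
Definition formally_etale :=
  forall (C D : comAlgType Kb) (q : {lrmorphism C -> D})
         (f : {lrmorphism B -> D}) (c : C),
    (forall d, exists x, q x = d) ->
    (forall x y, q x = 0 -> q y = 0 -> x * y = 0) ->
    q c = f t ->
  exists g : {lrmorphism B -> C},
    [/\ g t = c, q \o g =1 f
      & forall g' : {lrmorphism B -> C}, g' t = c -> q \o g' =1 f -> g' =1 g].

Definition is_point (z : Kb) (x : B -> Kb) :=
  [/\ linear_for *%R x, monoid_morphism x & x t = z].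

Definition galois_l := exists (G : finGroupType) (act : G -> {lrmorphism B -> B}),
  [/\ l.-nat #|{: G}|, act 1%g =1 id,
      forall g h, act (g * h)%g =1 act g \o act h,
      forall g, act g t = t
    & forall z : Kb, z != 0 -> z ^+ n != 1 ->
      (exists x, is_point z x) /\
      (forall x x', is_point z x -> is_point z x' ->
         exists! g, x' = x \o act g)].

Definition alg_hom_C (y : B -> R[i]) :=
  linear_for (fun (a : Kb) (c : R[i]) => kval a * c) y /\ monoid_morphism y.

(* A continuous section, over the open segment ]0, 1[ * u, of the covering    *)
(* of V_n(C) given by B: [y r] is a complex point of B above r * u.           *)
(* Extending by 0 makes equality of functions equality of sections.           *)
Definition is_section (u : R[i]) (y : R -> B -> R[i]) :=
  [/\ forall r, r \in `]0, 1[ -> alg_hom_C (y r) /\ y r t = (r%:C)%C * u,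
      forall b, {in `]0, 1[, continuous ((fun r => y r b) : R -> R[i]^o)}
    & forall r, r \notin `]0, 1[ -> forall b, y r b = 0].

End Algebras.

(* Finite etale covers of V_n (x) Kbar that are torsors under finite l-groups *)
(* (connected or not). The connected ones are the finite quotients of         *)
(* pi_1^{pro-l}, so that isomorphisms between fibre functors on these covers  *)
(* are the pro-l etale paths.                                                 *)
Record lcover (n : nat) := Cover {
  calg :> comAlgType Kb;
  ct : calg;
  cover_V : alg_over_V n ct;
  cover_finite : module_finite n ct;
  cover_etale : formally_etale ct;
  cover_galois : galois_l n ct }.

(* [Tangential u], for |u| = 1, is the tangent vector u at 0. Its fibre       *)
(* functor is that of sections near 0 on the ray of direction u; V_n contains *)
(* the whole contractible segment ]0, 1[ * u, so these are the sections over  *)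
(* that segment.                                                              *)
Inductive basepoint := Tangential of R[i] | Point of Kb.

Definition fibre n (a : basepoint) (B : lcover n) : Type :=
  match a with
  | Tangential u => {y : R -> B -> R[i] | is_section (ct B) u y}
  | Point z => {x : B -> Kb | is_point (ct B) z x}
  end.

Definition sect n u (B : lcover n) (y : fibre (Tangential u) B) : R -> B -> R[i] :=
  sval y.
Definition eval_at n z (B : lcover n) (x : fibre (Point z) B) : B -> Kb := sval x.

(* phi is a morphism of covers above the map z |-> c z^e from V_n to V_n',  *)
(* which maps r * u to r^e * (c u^e); [above] says that it maps x to x'.      *)
Definition above n n' (e : nat) (B : lcover n) (B' : lcover n') (phi : B' -> B)
    a a' : fibre a B -> fibre a' B' -> Prop :=
  match a, a' with
  | Tangential u, Tangential u' => fun y y' =>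
      forall r, r \in `]0, 1[ -> sect y' (r ^+ e) =1 sect y r \o phi
  | Point z, Point z' => fun x x' => eval_at x' =1 eval_at x \o phi
  | _, _ => fun _ _ => False
  end.

(* gamma' is the image of gamma under z |-> c z^e: its effect on a cover B'   *)
(* of V_n' is that of gamma on the pull-back of B' to V_n, hence on any B     *)
(* mapping to that pull-back.                                                 *)
Definition image_under n n' (c : Kb) (e : nat) a b a' b'
    (gamma : forall B : lcover n, fibre a B -> fibre b B)
    (gamma' : forall B' : lcover n', fibre a' B' -> fibre b' B') :=
  forall (B : lcover n) (B' : lcover n') (phi : {lrmorphism B' -> B}),
    phi (ct B') = c *: ct B ^+ e ->
  forall (x : fibre a B) (x' : fibre a' B'),
    above e phi x x' -> above e phi (gamma B x) (gamma' B' x').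

Record etale_path n (a b : basepoint) := Path {
  transport :> forall B : lcover n, fibre a B -> fibre b B;
  transport_bij : forall B, bijective (@transport B);
  transport_natural : image_under 1 1 transport transport }.

Fact path_comp_bij n a b c (p : etale_path n a b) (q : etale_path n b c) B :
  bijective (fun x : fibre a B => q B (p B x)).
Proof. exact: bij_comp (transport_bij q B) (transport_bij p B). Qed.

Fact path_comp_natural n a b c (p : etale_path n a b) (q : etale_path n b c) :
  image_under 1 1 (fun B x => q B (p B x)) (fun B x => q B (p B x)).
Proof.
move=> B B' phi ht x x' xx'; apply: transport_natural => //.
exact: transport_natural.
Qed.

Definition path_comp n a b c (p : etale_path n a b) (q : etale_path n b c) : etale_path n a c :=
  Path (path_comp_bij p q) (path_comp_natural p q).

(* Continuation along the anticlockwise arcs r e^{i phi}, 0 <= phi <= theta.  *)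
Definition is_arc n theta u (delta : etale_path n (Tangential 1) (Tangential u)) :=
  forall (B : lcover n) (y : fibre (Tangential 1) B) (r : R), r \in `]0, 1[ ->
  exists Y : R -> B -> R[i],
    [/\ forall phi, phi \in `[0, theta] ->
          alg_hom_C (Y phi) /\ Y phi (ct B) = (r%:C)%C * expi phi,
        forall b, {within `[0, theta], continuous ((fun phi => Y phi b) : R -> R[i]^o)},
        Y 0 =1 sect y r & Y theta =1 sect (delta B y) r].

(* v is the value at w of the continuation along p of the function g, which   *)
(* is regular on some cover with a chosen section y over ]0, 1[.              *)
Definition continues n w (p : etale_path n (Tangential 1) (Point w))
    (g : R -> R[i]) (v : Kb) :=
  exists (B : lcover n) (y : fibre (Tangential 1) B) (b : B),
    (forall r, r \in `]0, 1[ -> sect y r b = g r) /\ eval_at (p B y) b = v.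

(* the branch of t^{1/l^m} that is positive on ]0, 1[ *)
Definition t_branch m (h : R -> R[i]) :=
  forall r, r \in `]0, 1[ -> 0 < h r /\ h r ^+ (l ^ m) = (r%:C)%C.

(* the branch of (1 - zeta_{l^m}^alpha t^{1/l^m})^{1/l^m} that tends to 1 at 0 *)
Definition one_minus_t_branch m (alpha : int) (g : R -> R[i]) :=
  [/\ exists2 h, t_branch m h &
        (forall r, r \in `]0, 1[ ->
           g r ^+ (l ^ m) = 1 - zeta R (l ^ m) ^ alpha * h r),
      {in `]0, 1[, continuous (g : R -> R[i]^o)}
    & (g : R -> R[i]^o) r @[r --> 0^'+] --> (1 : R[i]^o)].

Record roots_along w (p : etale_path 1 (Tangential 1) (Point w)) := RootsAlong {
  w_root : nat -> Kb;
  one_minus_w_root : nat -> int -> Kb;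
  w_rootP : forall m, exists2 h, t_branch m h & continues p h (w_root m);
  one_minus_w_rootP : forall m alpha,
    exists2 g, one_minus_t_branch m alpha g
             & continues p g (one_minus_w_root m alpha) }.

Definition is_cyclotomic_char (chi : galois_aut K -> padic_unit l) :=
  forall (sigma : galois_aut K) m, sigma (zetaK K (l ^ m)) = zetaK K (l ^ m) ^ chi sigma m.

Definition is_kummer_char w (p : etale_path 1 (Tangential 1) (Point w))
    (rt : roots_along p) (rho : galois_aut K -> padic_int l) :=
  forall (sigma : galois_aut K) m,
    sigma (w_root rt m) = zetaK K (l ^ m) ^ rho sigma m * w_root rt m.

Definition is_polylog_char (chi : galois_aut K -> padic_unit l) (k : nat)
    w (p : etale_path 1 (Tangential 1) (Point w))
    (chik : galois_aut K -> padic_int l) :=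
  forall (rt : roots_along p) (rho : galois_aut K -> padic_int l),
    is_kummer_char rt rho ->
  forall (sigma : galois_aut K) m, (0 < m)%N ->
  zetaK K (l ^ m) ^ chik sigma m =
    sigma (\prod_(0 <= a < l ^ m)
             one_minus_w_root rt m (pinv (chi sigma) m * a%:Z) ^+ (a ^ k.-1))
    / \prod_(0 <= a < l ^ m)
        one_minus_w_root rt m (a%:Z + rho sigma m) ^+ (a ^ k.-1).

End Covers.

(* Main.v *)
(* Put N = l^m and w = exp(2 pi i / nN). The l-adic polylogarithms at level m   *)
(* are read off on the cover C(n, N) of V_n given by                             *)
(*   x^N = t,  y_j^N = 1 - w^j x  (j mod nN),                                    *)
(* a torsor under the wreath product of Z/N by Z/N. Transporting along gamma     *)
(* the section where x > 0 and the y_j are principal roots produces numbers X    *)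
(* and Y_j. The maps z |-> z^n and z |-> zeta_n^s z lift to morphisms of covers  *)
(* under which the roots needed at z^n become prod_(s < n) Y_(a + sN), and those *)
(* needed at zeta_n^s z become Y_(na + s), the arc delta_s accounting for        *)
(* x |-> w^s x. If sigma maps w to w^c and X to zeta_N^r X, then sigma maps Y_j  *)
(* to zeta_N^(kap j) Y_(cj + nr), and modulo N both sides of the identity are    *)
(* the sum of kap j (chi(sigma) j)^(k-1) over j mod nN: with j = a / chi + sN    *)
(* on the left and j = n b / chi + s on the right, where the binomial theorem    *)
(* expands (n b + s chi)^(k-1).                                                  *)

Require Import Defs.
From HB Require Import structures.
From mathcomp Require Import all_boot all_order all_algebra all_fingroup generic_quotient.
From mathcomp Require Import complex ring lra.
From mathcomp Require Import all_classical all_reals all_analysis.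
Set Implicit Arguments.
Unset Strict Implicit.
Unset Printing Implicit Defensive.
Import Order.TTheory GRing.Theory Num.Theory.
Local Open Scope ring_scope.

(** * Commutative algebras given by generators and relations *)

(** The classical model is the distribution relation of polylogarithms, which comes from the
    factorization of 1 - z^n into the 1 - zeta_n^s z. Here the characters are exponents of roots of
    unity, so the relation becomes a count of how one sigma acts on one family of numbers, the
    transported roots Y_j of 1 - w^j X on a single Kummer cover of V_n. The roots at z^n group the
    Y_j by j mod N, those at zeta_n^s z group them by j mod n. The terms of degree d < k appear
    because the arc to zeta_n^s multiplies x by w^s, so that the weight attached to Y_j mixes b and
    s.

    The geometric half makes this cover an [lcover]: [kummer_formally_etale], [kummer_module_finite]
    and [kummer_galois], assembled in [kummer_cover]. Its fibre contains a distinguished section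
    made of principal roots ([standard_section]), and [pow_transport] and [shift_transport], the
    latter through [arc_standard], compare the transports of these sections at z, z^n and zeta_n^s
    z. [standard_roots] turns the transported values into the roots that the definition of the
    characters asks for.

    The arithmetic half works modulo l^m. [galois_shift] describes sigma on the Y_j, [galois_prod]
    and [galois_residue] restrict this to the two groupings, [polylog_sum] takes logarithms to the
    base zeta_(l^m), and [distribution_sum] equates the two resulting sums, after which the binomial
    theorem concludes. *)

Section PresentedAlgebra.
Variables (F : comNzRingType) (V : Type).

Inductive term :=
  | Const of F | Gen of V | Plus of term & term | Times of term & term.

HB.instance Definition _ := gen_eqMixin term.
HB.instance Definition _ := gen_choiceMixin term.

Fixpoint teval (D : comPzRingType) (e : F -> D) (v : V -> D) (s : term) : D :=
  match s with
  | Const a => e a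
  | Gen i => v i
  | Plus s1 s2 => teval e v s1 + teval e v s2
  | Times s1 s2 => teval e v s1 * teval e v s2
  end.

Variable relations : term -> term -> Prop.

Inductive cong : term -> term -> Prop :=
  | CongRel s1 s2 of relations s1 s2 : cong s1 s2
  | CongRefl s : cong s s
  | CongSym s1 s2 of cong s1 s2 : cong s2 s1
  | CongTrans s1 s2 s3 of cong s1 s2 & cong s2 s3 : cong s1 s3
  | CongPlus s1 s2 s1' s2' of cong s1 s1' & cong s2 s2' :
      cong (Plus s1 s2) (Plus s1' s2')
  | CongTimes s1 s2 s1' s2' of cong s1 s1' & cong s2 s2' :
      cong (Times s1 s2) (Times s1' s2')
  | CongPlusA s1 s2 s3 : cong (Plus s1 (Plus s2 s3)) (Plus (Plus s1 s2) s3)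
  | CongPlusC s1 s2 : cong (Plus s1 s2) (Plus s2 s1)
  | CongPlus0 s : cong (Plus (Const 0) s) s
  | CongPlusN s : cong (Plus (Times (Const (- 1)) s) s) (Const 0)
  | CongTimesA s1 s2 s3 : cong (Times s1 (Times s2 s3)) (Times (Times s1 s2) s3)
  | CongTimesC s1 s2 : cong (Times s1 s2) (Times s2 s1)
  | CongTimes1 s : cong (Times (Const 1) s) s
  | CongTimesDl s1 s2 s3 :
      cong (Times (Plus s1 s2) s3) (Plus (Times s1 s3) (Times s2 s3))
  | CongConstD a b : cong (Const (a + b)) (Plus (Const a) (Const b))
  | CongConstM a b : cong (Const (a * b)) (Times (Const a) (Const b)).

Lemma teval_cong (D : comPzRingType) (e : {rmorphism F -> D}) (v : V -> D) :
    (forall s1 s2, relations s1 s2 -> teval e v s1 = teval e v s2) ->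
  forall s1 s2, cong s1 s2 -> teval e v s1 = teval e v s2.
Proof.
move=> hrel s1 s2; elim=> //=.
- by move=> ? ? ? _ -> _ ->.
- by move=> ? ? ? ? _ -> _ ->.
- by move=> ? ? ? ? _ -> _ ->.
- by move=> *; rewrite addrA.
- by move=> *; rewrite addrC.
- by move=> *; rewrite rmorph0 add0r.
- by move=> *; rewrite rmorph0 rmorphN1 mulN1r addNr.
- by move=> *; rewrite mulrA.
- by move=> *; rewrite mulrC.
- by move=> *; rewrite rmorph1 mul1r.
- by move=> *; rewrite mulrDl.
- by move=> *; rewrite rmorphD.
- by move=> *; rewrite rmorphM.
Qed.

Definition congb : rel term := fun s1 s2 => `[< cong s1 s2 >].

Fact congb_equiv : equiv_class_of congb.
Proof.
split=> [s|s1 s2|s2 s1 s3 /asboolP h12 /asboolP h23].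
- by apply/asboolP; exact: CongRefl.
- by apply/asboolP/asboolP; exact: CongSym.
- by apply/asboolP; exact: CongTrans h12 h23.
Qed.
Canonical congb_equivRel := EquivRelPack congb_equiv.

(* Algebra structures of the library are nontrivial rings; [presented] takes  *)
(* the nontriviality of the presentation as an argument for this reason.      *)
Definition presented (_ : ~ cong (Const 1) (Const 0)) := {eq_quot congb}%qT.

Hypothesis nontriv : ~ cong (Const 1) (Const 0).
Local Notation P := (presented nontriv).

HB.instance Definition _ := Choice.on P.
HB.instance Definition _ := EqQuotient.on P.

Definition cls (s : term) : P := (\pi_({eq_quot congb}) s)%qT.

Lemma cls_eq s1 s2 : cls s1 = cls s2 <-> cong s1 s2.
Proof.
rewrite /cls; split=> [/eqP|h]; first by rewrite eqmodE => /asboolP.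
by apply/eqP; rewrite eqmodE; apply/asboolP.
Qed.

Lemma cls_surj (x : P) : exists s, x = cls s.
Proof. by exists (repr (x : {eq_quot congb}%qT)); rewrite /cls reprK. Qed.

Lemma cong_repr s : cong (repr (cls s : {eq_quot congb}%qT)) s.
Proof. by apply/cls_eq; rewrite /cls reprK. Qed.

Definition pres_add (x y : P) : P :=
  cls (Plus (repr (x : {eq_quot congb}%qT)) (repr (y : {eq_quot congb}%qT))).
Definition pres_mul (x y : P) : P :=
  cls (Times (repr (x : {eq_quot congb}%qT)) (repr (y : {eq_quot congb}%qT))).

Lemma cls_add s1 s2 : pres_add (cls s1) (cls s2) = cls (Plus s1 s2).
Proof. by apply/cls_eq; apply: CongPlus; exact: cong_repr. Qed.
Lemma cls_mul s1 s2 : pres_mul (cls s1) (cls s2) = cls (Times s1 s2).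
Proof. by apply/cls_eq; apply: CongTimes; exact: cong_repr. Qed.

Definition pres_opp (x : P) := pres_mul (cls (Const (-1))) x.

Fact pres_addA : associative pres_add.
Proof.
move=> x y z; have [a ->] := cls_surj x; have [b ->] := cls_surj y.
by have [c ->] := cls_surj z; rewrite !cls_add; apply/cls_eq/CongPlusA.
Qed.
Fact pres_addC : commutative pres_add.
Proof.
move=> x y; have [a ->] := cls_surj x; have [b ->] := cls_surj y.
by rewrite !cls_add; apply/cls_eq/CongPlusC.
Qed.
Fact pres_add0 : left_id (cls (Const 0)) pres_add.
Proof. by move=> x; have [a ->] := cls_surj x; rewrite cls_add; apply/cls_eq/CongPlus0. Qed.
Fact pres_addN : left_inverse (cls (Const 0)) pres_opp pres_add.
Proof.
by move=> x; have [a ->] := cls_surj x; rewrite /pres_opp cls_mul cls_add; apply/cls_eq/CongPlusN.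
Qed.
HB.instance Definition _ := GRing.isZmodule.Build P pres_addA pres_addC pres_add0 pres_addN.

Fact pres_mulA : associative pres_mul.
Proof.
move=> x y z; have [a ->] := cls_surj x; have [b ->] := cls_surj y.
by have [c ->] := cls_surj z; rewrite !cls_mul; apply/cls_eq/CongTimesA.
Qed.
Fact pres_mulC : commutative pres_mul.
Proof.
move=> x y; have [a ->] := cls_surj x; have [b ->] := cls_surj y.
by rewrite !cls_mul; apply/cls_eq/CongTimesC.
Qed.
Fact pres_mul1 : left_id (cls (Const 1)) pres_mul.
Proof. by move=> x; have [a ->] := cls_surj x; rewrite cls_mul; apply/cls_eq/CongTimes1. Qed.
Fact pres_mulDl : left_distributive pres_mul pres_add.
Proof.
move=> x y z; have [a ->] := cls_surj x; have [b ->] := cls_surj y.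
by have [c ->] := cls_surj z; rewrite !(cls_mul, cls_add); apply/cls_eq/CongTimesDl.
Qed.
Fact pres_nz : cls (Const 1) != cls (Const 0).
Proof. by apply/eqP => /cls_eq. Qed.
HB.instance Definition _ :=
  GRing.Zmodule_isComNzRing.Build P pres_mulA pres_mulC pres_mul1 pres_mulDl pres_nz.

Lemma clsD s1 s2 : cls (Plus s1 s2) = cls s1 + cls s2.
Proof. by rewrite -cls_add. Qed.
Lemma clsM s1 s2 : cls (Times s1 s2) = cls s1 * cls s2.
Proof. by rewrite -cls_mul. Qed.

Definition pres_scale (a : F) (x : P) : P := cls (Const a) * x.

Fact pres_scaleA a b v : pres_scale a (pres_scale b v) = pres_scale (a * b) v.
Proof. by rewrite /pres_scale mulrA -clsM; congr (_ * _); apply/cls_eq/CongSym/CongConstM. Qed.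
Fact pres_scale1 : left_id 1 pres_scale.
Proof. by move=> x; rewrite /pres_scale mul1r. Qed.
Fact pres_scaleDr : right_distributive pres_scale +%R.
Proof. by move=> a x y; rewrite /pres_scale mulrDr. Qed.
Fact pres_scaleDl v : {morph pres_scale^~ v : a b / a + b}.
Proof.
by move=> a b; rewrite /pres_scale -mulrDl -clsD; congr (_ * _); apply/cls_eq/CongConstD.
Qed.
HB.instance Definition _ := GRing.Zmodule_isLmodule.Build F P
  pres_scaleA pres_scale1 pres_scaleDr pres_scaleDl.
Fact pres_scaleAl (a : F) (x y : P) : a *: (x * y) = a *: x * y.
Proof. exact: mulrA. Qed.
HB.instance Definition _ := GRing.Lmodule_isLalgebra.Build F P pres_scaleAl.
Fact pres_scaleAr (a : F) (x y : P) : a *: (x * y) = x * (a *: y).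
Proof. exact: mulrCA. Qed.
HB.instance Definition _ := GRing.Lalgebra_isAlgebra.Build F P pres_scaleAr.

Definition pgen (i : V) : P := cls (Gen i).

Lemma cls_const a : cls (Const a) = a%:A.
Proof. by rewrite -[LHS]mulr1. Qed.

Lemma cls_teval s : cls s = teval (in_alg P) pgen s.
Proof.
elim: s => [a|i|s IHs t IHt|s IHs t IHt] //=; first exact: cls_const.
  by rewrite clsD IHs IHt.
by rewrite clsM IHs IHt.
Qed.

Lemma presented_ind (Q : P -> Prop) :
    (forall a, Q a%:A) -> (forall i, Q (pgen i)) ->
    (forall x y, Q x -> Q y -> Q (x + y)) -> (forall x y, Q x -> Q y -> Q (x * y)) ->
  forall x, Q x.
Proof.
move=> Qc Qg Qa Qm x; have [s ->] := cls_surj x; rewrite cls_teval.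
by elim: s => [a|i|s IHs t IHt|s IHs t IHt] /=; auto.
Qed.

Lemma pgen_rel s1 s2 : relations s1 s2 -> teval (in_alg P) pgen s1 = teval (in_alg P) pgen s2.
Proof. by move=> h; rewrite -!cls_teval; apply/cls_eq/CongRel. Qed.

Section Lift.
Variables (D : comPzRingType) (e : {rmorphism F -> D}) (v : V -> D).
Hypothesis vP : forall s1 s2, relations s1 s2 -> teval e v s1 = teval e v s2.

(** The target is only a ring with a map from [F], because points of a cover also take values in the
    complex numbers, on which [Kbar K] acts through [kval]. [presented_lift] is the version for
    algebras. *)
Definition plift (x : P) : D := teval e v (repr (x : {eq_quot congb}%qT)).

Lemma plift_cls s : plift (cls s) = teval e v s.
Proof. by apply: (teval_cong vP); exact: cong_repr. Qed.

Lemma pliftD : {morph plift : x y / x + y}.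
Proof.
move=> x y; have [a ->] := cls_surj x; have [b ->] := cls_surj y.
by rewrite -clsD !plift_cls.
Qed.

Lemma plift_monoid : monoid_morphism plift.
Proof.
split=> [|x y]; first by rewrite plift_cls /= rmorph1.
have [a ->] := cls_surj x; have [b ->] := cls_surj y.
by rewrite -clsM !plift_cls.
Qed.

Lemma pliftZ a x : plift (a *: x) = e a * plift x.
Proof. by rewrite -mulr_algl -cls_const plift_monoid.2 plift_cls. Qed.

Lemma plift_gen i : plift (pgen i) = v i.
Proof. exact: plift_cls. Qed.

End Lift.

Lemma presented_lift (D : comAlgType F) (v : V -> D) :
    (forall s1 s2, relations s1 s2 -> teval (in_alg D) v s1 = teval (in_alg D) v s2) ->
  exists f : {lrmorphism P -> D}, forall i, f (pgen i) = v i.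
Proof.
move=> vP; pose f := plift (in_alg D) v.
have fB : {morph f : x y / x - y}.
  move=> x y; apply/(addIr (f y)).
  by rewrite -pliftD // subrK addrNK.
have fZ : scalable f by move=> a x; rewrite /f pliftZ // mulr_algl.
pose fa := GRing.isZmodMorphism.Build P D f fB.
pose fm := GRing.isMonoidMorphism.Build P D f (plift_monoid vP).
pose fs := GRing.isScalable.Build F P D *:%R f fZ.
pose g : {lrmorphism P -> D} :=
  HB.pack f fa fm fs.
by exists g => i; exact: plift_gen.
Qed.

End PresentedAlgebra.

(** * Roots of unity and square-zero extensions *)

Section UnityPowers.
Variables (F : fieldType) (N : nat) (w : F).
Hypothesis w_prim : N.-primitive_root w.

Lemma unity_neq0 : w != 0.
Proof.
apply/eqP => w0; have /eqP := prim_expr_order w_prim.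
by rewrite w0 expr0n gtn_eqF ?(prim_order_gt0 w_prim) // eq_sym oner_eq0.
Qed.

Lemma unity_exprz_mod (i : int) : w ^ (i %% N%:Z)%Z = w ^ i.
Proof.
rewrite [in RHS](divz_eq i N%:Z) [in RHS]expfzDr ?unity_neq0 // [RHS]mulrC.
by rewrite -exprz_exp exprzAC [w ^ N%:Z]prim_expr_order // exp1rz mulr1.
Qed.

Lemma eq_unity_exprz (i j : int) : (w ^ i == w ^ j) = (i == j %[mod N%:Z])%Z.
Proof.
have N0 : N%:Z != 0 by rewrite eqz_nat -lt0n (prim_order_gt0 w_prim).
rewrite -(unity_exprz_mod i) -(unity_exprz_mod j).
have := modz_ge0 i N0; have := modz_ge0 j N0.
have := ltz_mod i N0; have := ltz_mod j N0.
case: (i %% _)%Z => // a; case: (j %% _)%Z => // b.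
rewrite !(gtr0_norm (_ : 0 < N%:Z)) ?ltz_nat ?(prim_order_gt0 w_prim) // => bN aN _ _.
by rewrite -!exprnP (eq_prim_root_expr w_prim) !modn_small.
Qed.

Lemma unity_rootz (x : F) : x ^+ N = 1 -> exists2 i : nat, (i < N)%N & x = w ^+ i.
Proof. by move=> /(prim_rootP w_prim)[i ->]; exists i. Qed.

(** The identity is proved for polynomials and then specialized at [u]. Since 1 - w^i X = - w^i (X -
    w^(-i)), it is the factorization of X^N - 1 by the powers of w^(-1), up to a constant. *)
Lemma prod_one_sub (D : comNzRingType) (e : {rmorphism F -> D}) (u : D) :
  \prod_(i < N) (1 - e (w ^+ i) * u) = 1 - u ^+ N.
Proof.
have N0 := prim_order_gt0 w_prim.
have wV_prim : N.-primitive_root (w^-1).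
  apply/andP; split=> //; apply/forallP => i; rewrite unity_rootE exprVn invr_eq1.
  by have /andP[_ /forallP/(_ i)] := w_prim; rewrite unity_rootE.
have key : \prod_(i < N) (1 - (w ^+ i)%:P * 'X) = 1 - 'X^N :> {poly F}.
  pose c := \prod_(i < N) (- w ^+ i).
  have h : \prod_(i < N) (1 - (w ^+ i)%:P * 'X) = c%:P * ('X^N - 1).
    rewrite -(factor_Xn_sub_1 wV_prim) big_mkord rmorph_prod -big_split /=.
    apply: eq_bigr => i _; rewrite mulrBr -polyCM mulNr exprVn divff ?expf_neq0 ?unity_neq0 //.
    by rewrite !polyCN mulNr opprK addrC.
  (* Evaluation at 0 determines the constant: 1 = - c. *)
  have := congr1 (fun p : {poly F} => p.[0]) h.
  rewrite horner_prod big1 => [|i _]; last by rewrite !hornerE subr0.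
  rewrite !hornerE expr0n gtn_eqF //= sub0r mulrN1 => c1.
  by rewrite h -[c]opprK -c1 polyCN mulN1r opprB.
have cu : commr_rmorph e u by move=> a; exact: mulrC.
have := congr1 (horner_morph cu) key.
rewrite rmorph_prod rmorphB rmorph1 rmorphXn /= horner_morphX => <-.
apply: eq_bigr => i _; rewrite rmorphB rmorph1 rmorphM /= horner_morphX.
by rewrite horner_morphC.
Qed.

End UnityPowers.

Section Zeta.
Variables (R : realType) (K : divringClosed R[i]).
Local Notation z_ := (zetaK K).

Lemma zeta_prim N : (0 < N)%N -> N.-primitive_root (zeta R N).
Proof.
move=> N0; apply/andP; split=> //; apply/forallP => -[i /= iN].
rewrite unity_rootE.
apply/eqP.
have [->|iN1] := eqVneq i.+1 N; first exact/eqP/zeta_unity.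
apply/negbTE.
have {iN iN1} iN : (i.+1 < N)%N by rewrite ltn_neqAle iN1.
rewrite expiX eq_complex /= negb_and; apply/orP; left.
have N0' : 0 < N%:R :> R by rewrite ltr0n.
(* Half of the angle of the power: it lies strictly between 0 and pi, so cos (2 th) = 1 - 2
   sin(th)^2 differs from 1. *)
pose th : R := pi * (i.+1)%:R / N%:R.
have -> : 2 * pi / N%:R *+ i.+1 = th *+ 2.
  rewrite /th -[LHS]mulr_natr -[RHS]mulr_natl -!mulrA.
  by congr (_ * (_ * _)); rewrite mulrC.
have : 0 < sin th.
  apply: sin_gt0_pi; rewrite /th divr_gt0 ?mulr_gt0 ?pi_gt0 ?ltr0n //=.
  by rewrite ltr_pdivrMr // ltr_pM2l ?pi_gt0 // ltr_nat.
rewrite cos_mulr2n cos2sin2; apply: contraTneq => h.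
have : sin th ^+ 2 = 0 by lra.
by move/eqP; rewrite sqrf_eq0 => /eqP ->; rewrite ltxx.
Qed.

Lemma zetaK_prim N : (0 < N)%N -> N.-primitive_root (z_ N).
Proof.
move=> N0; rewrite -(fmorph_primitive_root (val : {rmorphism Kbar K -> R[i]})).
exact: zeta_prim.
Qed.

Lemma zetaK_mul n N : (0 < n)%N -> (0 < N)%N -> z_ (n * N) ^+ n = z_ N.
Proof.
move=> n0 N0; apply/val_inj; rewrite rmorphXn /= /zeta expiX; congr (expi _).
rewrite -mulr_natr natrM; field.
by rewrite !pnatr_eq0 -!lt0n n0 N0.
Qed.

Lemma Kbar_root N (a : Kbar K) : (0 < N)%N -> exists b, b ^+ N = a.
Proof.
move=> N0; have [b bN] : exists b, b ^+ N = kval a by exists (N.-root (kval a))%C; rewrite rootCK.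
have balg : b \in algebraic_over K.
  case: a bN => a aalg /= bN.
  have /asboolP[p pK [p0 ra]] := aalg; apply/asboolP; exists (p \Po 'X^N).
    by apply: polyOver_comp => //; rewrite rpredX // polyOverX.
  split; last by rewrite rootE horner_comp hornerXn bN -rootE.
  apply: contra p0; by rewrite comp_poly_eq0 // size_polyXn ltnS.
by exists (MkKbar balg); apply/val_inj; rewrite rmorphXn.
Qed.

Lemma Kbar_natr_eq0 k : (k%:R == 0 :> Kbar K) = (k == 0)%N.
Proof.
by rewrite -(fmorph_eq0 (val : {rmorphism Kbar K -> R[i]})) rmorph_nat pnatr_eq0.
Qed.

End Zeta.

Section SquareZero.
Variables (C D : comNzRingType) (q : {rmorphism C -> D}).
Hypothesis q_surj : forall d, exists x, q x = d.
Hypothesis q_sqz : forall x y, q x = 0 -> q y = 0 -> x * y = 0.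

Lemma sqz_unit_mul a b e : q (a * b) = 1 -> q e = 0 -> (a * b) * e = e.
Proof.
move=> ab e0; apply/eqP; rewrite -subr_eq0 -[X in _ - X]mul1r -mulrBl.
by apply/eqP; apply: q_sqz => //; rewrite rmorphB rmorph1 ab subrr.
Qed.

Lemma sqz_unit a : (exists d, d * q a = 1) -> exists b, b * a = 1.
Proof.
move=> [d da]; have [b bd] := q_surj d; rewrite -bd -rmorphM in da.
(* With b a = 1 + e and e^2 = 0, the inverse of 1 + e is 1 - e. *)
exists (b * (1 - (b * a - 1))).
have e0 : q (b * a - 1) = 0 by rewrite rmorphB rmorph1 da subrr.
rewrite mulrAC -[X in X * _](subrK 1) addrC mulrBr mulr1 mulrDl mul1r.
by rewrite (q_sqz e0 e0) addr0 addrK.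
Qed.

Lemma exprD_sqz (u e : C) n : e * e = 0 ->
  (u + e) ^+ n = u ^+ n + n%:R * u ^+ n.-1 * e.
Proof.
move=> ee; elim: n => [|n IHn]; first by rewrite mul0r mul0r addr0.
rewrite exprS IHn /= mulrDl !mulrDr -[e * (_ * e)]mulrCA ee mulr0 addr0.
rewrite -exprS -addrA; congr (_ + _).
case: n {IHn} => [|n]; first by rewrite !mul0r mulr0 add0r !expr0 mulrC mulr1 mul1r.
by rewrite /= !exprS -[n.+2%:R]natr1; ring.
Qed.

Variables (n : nat) (n_inv : C).
Hypothesis n_invP : n_inv * n%:R = 1.

(** Writing v = u + e with e^2 = 0, equality of n-th powers says n u^(n-1) e = 0, and n u^(n-1) acts
    invertibly on the kernel of [q]. *)
Lemma sqz_root_uniq u v : (exists d, d * q u = 1) -> q u = q v ->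
  u ^+ n = v ^+ n -> u = v.
Proof.
move=> [d du] quv uvn; have [b bd] := q_surj d.
pose e := v - u; have e0 : q e = 0 by rewrite rmorphB quv subrr.
have ev : v = u + e by rewrite addrC subrK.
move: uvn; rewrite ev (exprD_sqz _ _ (q_sqz _ _)) // => /eqP.
rewrite -subr_eq0 opprD addrA subrr sub0r oppr_eq0 => /eqP h.
suff -> : e = 0 by rewrite addr0.
have bu : q (b ^+ n.-1 * u ^+ n.-1) = 1.
  by rewrite -exprMn rmorphXn rmorphM bd du expr1n.
rewrite -(sqz_unit_mul bu e0) -mulrA -[u ^+ _ * e]mul1r -n_invP.
by rewrite -(mulrA n_inv) (mulrA n%:R) h !mulr0.
Qed.

Lemma sqz_root c d : (0 < n)%N -> (exists d', d' * d = 1) -> q c = d ^+ n ->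
  exists2 u, u ^+ n = c & q u = d.
Proof.
move=> n0 [d' dd] qc; have [u ud] := q_surj d; have [b bd] := q_surj d'.
pose e := c - u ^+ n.
have e0 : q e = 0 by rewrite rmorphB rmorphXn qc ud subrr.
(* One Newton step e / (n u^(n-1)); it is exact because the error squares to zero. *)
pose f := n_inv * b ^+ n.-1 * e.
have f0 : q f = 0 by rewrite rmorphM e0 mulr0.
exists (u + f); last by rewrite rmorphD f0 addr0.
rewrite (exprD_sqz _ _ (q_sqz _ _)) // /f.
have -> : n%:R * u ^+ n.-1 * (n_inv * b ^+ n.-1 * e) =
   (n_inv * n%:R) * (u ^+ n.-1 * b ^+ n.-1 * e).
  by ring.
rewrite n_invP mul1r sqz_unit_mul // /e; first by rewrite addrC subrK.
by rewrite -exprMn rmorphXn rmorphM ud bd mulrC dd expr1n.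
Qed.

End SquareZero.

(** * The Kummer covers *)

Inductive kummer_gen := GenX | GenY of int | GenInv.

Section KummerCover.
Variables (R : realType) (K : divringClosed R[i]).
Local Notation Kb := (Kbar K).
Variables (n N : nat) (n_gt0 : (0 < n)%N) (N_gt0 : (0 < N)%N).
Local Notation M := (n * N)%N.
Local Notation w_ := (zetaK K M).

Let M_gt0 : (0 < M)%N. Proof. by rewrite muln_gt0 n_gt0. Qed.
Let w_prim : M.-primitive_root w_. Proof. exact: zetaK_prim. Qed.

Local Notation kterm := (term Kb kummer_gen).

(* [GenX] is x = t^(1/N) and [GenY j] is (1 - w^j x)^(1/N), indexed by all     *)
(* integers j with period nN; [GenInv] makes x and the y_j, hence t and        *)
(* 1 - t^n, invertible.                                                        *)
Inductive kummer_rel : kterm -> kterm -> Prop :=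
  | RelPeriod i j of (i = j %[mod M%:Z])%Z :
      kummer_rel (Gen _ (GenY i)) (Gen _ (GenY j))
  | RelRoot j : kummer_rel (iter N (Times (Gen _ (GenY j))) (Const _ 1))
      (Plus (Const _ 1) (Times (Const _ (- w_ ^ j)) (Gen _ GenX)))
  | RelInv : kummer_rel
      (Times (Gen _ GenInv) (Times (Gen _ GenX)
        (foldr (@Times _ _) (Const _ 1) [seq Gen _ (GenY (i : nat)) | i : 'I_M])))
      (Const _ 1).

(** These are the images of x, the y_j and the inverse under a homomorphism from the Kummer algebra
    to [D], by [kummer_hom] and [kummer_hom_data]. *)
Definition kummer_data (D : comPzRingType) (e : Kb -> D) (u : D) (v : int -> D) (u' : D) :=
  [/\ forall i j, (i = j %[mod M%:Z])%Z -> v i = v j,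
      forall j, v j ^+ N = 1 - e (w_ ^ j) * u
    & u' * (u * \prod_(j < M) v (j : nat)) = 1].

Definition gen_val (D : Type) (u : D) (v : int -> D) (u' : D) (g : kummer_gen) :=
  match g with GenX => u | GenY j => v j | GenInv => u' end.

Lemma kummer_dataP (D : comPzRingType) (e : {rmorphism Kb -> D}) u v u' :
  kummer_data e u v u' <-> forall s1 s2, kummer_rel s1 s2 ->
    teval e (gen_val u v u') s1 = teval e (gen_val u v u') s2.
Proof.
have powE s k : teval e (gen_val u v u') (iter k (Times s) (Const _ 1)) =
    teval e (gen_val u v u') s ^+ k.
  by elim: k => [|k /= ->]; rewrite ?expr0 ?exprS //= rmorph1.
have prodE : teval e (gen_val u v u')
    (foldr (@Times _ _) (Const _ 1) [seq Gen _ (GenY (i : nat)) | i : 'I_M]) =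
    \prod_(j < M) v (j : nat).
  rewrite -big_enum /= /image_mem /=; elim: (enum _) => [|a s /= ->] /=.
    by rewrite big_nil rmorph1.
  by rewrite big_cons.
split=> [[hp hr hi] s1 s2 []|h].
- by move=> i j ij; exact: hp.
- by move=> j; rewrite powE /= hr rmorph1 rmorphN mulNr.
- by rewrite /= prodE hi rmorph1.
split=> [i j ij|j|].
- by have := h _ _ (RelPeriod ij).
- by have := h _ _ (RelRoot j); rewrite powE /= rmorph1 rmorphN mulNr.
- by have := h _ _ RelInv; rewrite /= prodE rmorph1.
Qed.

Lemma kummer_one_sub_neq0 (x : Kb) j : x ^+ M != 1 -> 1 - w_ ^ j * x != 0.
Proof.
apply: contraNN; rewrite subr_eq0 => /eqP h.
have : (w_ ^ j * x) ^+ M = 1 by rewrite -h expr1n.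
rewrite exprMn.
have -> : (w_ ^ j) ^+ M = 1.
  by rewrite -[LHS]/((w_ ^ j) ^ M%:Z) exprzAC [w_ ^ M%:Z](prim_expr_order w_prim) exp1rz.
by rewrite mul1r => ->.
Qed.

Lemma kummer_point (x : Kb) : x != 0 -> x ^+ M != 1 ->
  exists v u', kummer_data id x v u'.
Proof.
move=> x0 xM.
(* Choosing the root as a function of the radicand makes v_j depend only on w^j, hence periodic in
   j. *)
have /choice[f fP] : forall a : Kb, exists b, b ^+ N = a.
  by move=> a; exact: Kbar_root.
pose v (j : int) := f (1 - w_ ^ j * x).
exists v, (x * \prod_(j < M) v (j : nat))^-1; split.
- by move=> i j /eqP; rewrite -(eq_unity_exprz w_prim) /v => /eqP ->.
- by move=> j; rewrite /v fP.
- apply: mulVf; apply: mulf_neq0 x0 _; apply/prodf_neq0 => j _.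
  apply: contraTneq (kummer_one_sub_neq0 (j : nat) xM) => vj.
  by have := fP (1 - w_ ^ j * x); rewrite -/(v j) vj expr0n gtn_eqF // => <-; rewrite eqxx.
Qed.

Lemma kummer_nontriv : ~ cong kummer_rel (Const _ 1) (Const _ 0).
Proof.
(* The algebra is nonzero because it has a point above t = 2, which lies on V_n as 2^n differs from
   1. *)
move=> h; have [x x2] := @Kbar_root R K N 2 N_gt0.
have x0 : x != 0.
  by apply: contraTneq isT => x0; move/eqP: x2; rewrite x0 expr0n gtn_eqF // eq_sym Kbar_natr_eq0.
have xM : x ^+ M != 1.
  rewrite mulnC exprM x2 -natrX -subr_eq0 -[X in _ - X]/(1%:R) -natrB ?expn_gt0 // Kbar_natr_eq0.
  by rewrite subn_eq0 -ltnNge -{1}(exp1n n) ltn_exp2r.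
have [v [u' /(@kummer_dataP Kb idfun) vP]] := kummer_point x0 xM.
by have /eqP := teval_cong vP h; rewrite /= oner_eq0.
Qed.

Definition kummer_alg := presented kummer_nontriv.
HB.instance Definition _ := GRing.ComAlgebra.on kummer_alg.

Definition kx : kummer_alg := pgen kummer_nontriv GenX.
Definition ky (j : int) : kummer_alg := pgen kummer_nontriv (GenY j).
Definition kinv : kummer_alg := pgen kummer_nontriv GenInv.
Definition kt := kx ^+ N.

Lemma kummer_alg_data : kummer_data (in_alg kummer_alg) kx ky kinv.
Proof.
apply/kummer_dataP => s1 s2 h.
have := pgen_rel kummer_nontriv h.
have e : pgen kummer_nontriv =1 gen_val kx ky kinv by case.
by rewrite (funext e).
Qed.

Lemma kummer_lift (D : comAlgType Kb) u v u' : kummer_data (in_alg D) u v u' ->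
  exists f : {lrmorphism kummer_alg -> D}, f kx = u /\ forall j, f (ky j) = v j.
Proof.
move=> /kummer_dataP vP; have [f fP] := presented_lift kummer_nontriv vP.
by exists f; split=> [|j]; rewrite fP.
Qed.

(** A common form for points over [Kbar K] ([e] the identity), complex points ([e] = [kval]) and
    algebra morphisms ([e] = [in_alg D]), so that each fact about the generators is proved once. *)
Definition hom_over (A : comAlgType Kb) (D : comPzRingType) (e : Kb -> D) (f : A -> D) :=
  linear_for (fun a c => e a * c) f /\ monoid_morphism f.

Lemma kummer_hom (D : comPzRingType) (e : {rmorphism Kb -> D}) u v u' :
    kummer_data e u v u' ->
  exists f : kummer_alg -> D, [/\ hom_over e f, f kx = u, forall j, f (ky j) = v j
    & f kinv = u'].
Proof.
move=> /kummer_dataP vP; exists (plift e (gen_val u v u')); split.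
- split; last exact: plift_monoid.
  by move=> a x y; rewrite pliftD // pliftZ.
- exact: plift_gen.
- by move=> j; exact: plift_gen.
- exact: plift_gen.
Qed.

Lemma hom_overD (A : comAlgType Kb) (D : comPzRingType) (e : {rmorphism Kb -> D}) (f : A -> D) :
  hom_over e f -> {morph f : x y / x + y}.
Proof. by case=> fl _ x y; rewrite -[x]scale1r fl rmorph1 mul1r scale1r. Qed.

Lemma hom_overZ (A : comAlgType Kb) (D : comPzRingType) (e : {rmorphism Kb -> D}) (f : A -> D) :
  hom_over e f -> forall a x, f (a *: x) = e a * f x.
Proof.
move=> fP a x; have [fl _] := fP.
have f0 : f 0 = 0.
  by apply: (addrI (f 0)); rewrite -(hom_overD fP) !addr0.
by rewrite -[a *: x]addr0 fl f0 addr0.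
Qed.

Lemma hom_overX (A : comAlgType Kb) (D : comPzRingType) (e : {rmorphism Kb -> D}) (f : A -> D) :
  hom_over e f -> forall x k, f (x ^+ k) = f x ^+ k.
Proof.
by move=> [_ [f1 fM]] x; elim=> [|k IHk]; rewrite ?expr0 ?exprS ?f1 // fM IHk.
Qed.

Lemma hom_over_prod (A : comAlgType Kb) (D : comPzRingType) (e : {rmorphism Kb -> D}) (f : A -> D) :
  hom_over e f -> forall (I : finType) (F : I -> A), f (\prod_i F i) = \prod_i f (F i).
Proof. by move=> [_ [f1 fM]] I F; exact: (big_morph f fM f1). Qed.

Lemma lrmorph_hom_over (A D : comAlgType Kb) (f : {lrmorphism A -> D}) :
  hom_over (in_alg D) f.
Proof.
split; last by split; [exact: rmorph1|exact: rmorphM].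
by move=> a x y; rewrite linearP mulr_algl.
Qed.

Lemma kummer_hom_data (D : comPzRingType) (e : {rmorphism Kb -> D}) f :
  hom_over e f -> kummer_data e (f kx) (f \o ky) (f kinv).
Proof.
move=> fP; have [fl [f1 fM]] := fP; have [hp hr hi] := kummer_alg_data.
split=> [i j ij|j|] /=.
- by rewrite (hp _ _ ij).
- rewrite -(hom_overX fP) hr -mulNr -scaleN1r -scalerAl scaleN1r -mulNr.
  rewrite (hom_overD fP) f1; congr (_ + _).
  by rewrite mulNr -[- (_ * _)]scaleN1r mulr_algl scalerA mulN1r (hom_overZ fP) rmorphN mulNr.
- by rewrite -(hom_over_prod fP) -!fM hi f1.
Qed.

(** The image of [kinv] needs no hypothesis, being the inverse of an element already determined. *)
Lemma kummer_hom_uniq (D : comPzRingType) (e : {rmorphism Kb -> D}) f g :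
  hom_over e f -> hom_over e g -> f kx = g kx -> (forall j, f (ky j) = g (ky j)) -> f =1 g.
Proof.
move=> fP gP xE yE.
have [_ _ hf] := kummer_hom_data fP; have [_ _ hg] := kummer_hom_data gP.
have iE : f kinv = g kinv.
  rewrite -[LHS]mulr1 -hg mulrCA -xE.
  have -> : \prod_(j < M) (g \o ky) (j : nat) = \prod_(j < M) (f \o ky) (j : nat).
    by apply: eq_bigr => j _; rewrite /= yE.
  by rewrite hf mulr1.
have [_ [f1 fM]] := fP; have [_ [g1 gM]] := gP.
apply: presented_ind => [a|[|j|]|x y fx fy|x y fx fy].
- by rewrite (hom_overZ fP) (hom_overZ gP) f1 g1.
- exact: xE.
- exact: yE.
- exact: iE.
- by rewrite (hom_overD fP) (hom_overD gP) fx fy.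
- by rewrite fM gM fx fy.
Qed.

Lemma kummer_lr_uniq (D : comAlgType Kb) (f g : {lrmorphism kummer_alg -> D}) :
  f kx = g kx -> (forall j, f (ky j) = g (ky j)) -> f =1 g.
Proof. by apply: kummer_hom_uniq; exact: lrmorph_hom_over. Qed.

(** For the generators, u^M = t^n: inverting the y_j is the same as inverting 1 - t^n. *)
Lemma kummer_prod (D : comNzRingType) (e : {rmorphism Kb -> D}) u v u' :
  kummer_data e u v u' -> (\prod_(j < M) v (j : nat)) ^+ N = 1 - u ^+ M.
Proof.
move=> [_ hr _]; rewrite -prodrXl -(prod_one_sub w_prim e).
by apply: eq_bigr => j _; rewrite hr.
Qed.

Lemma kummer_units (D : comNzRingType) (e : {rmorphism Kb -> D}) u v u' :
  kummer_data e u v u' -> (exists d, d * u = 1) /\ forall j, exists d, d * v j = 1.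
Proof.
move=> [hp _ hi]; split; first by exists (u' * \prod_(j < M) v (j : nat)); rewrite mulrAC -mulrA.
have [d0 d0P] : exists d, d * \prod_(j < M) v (j : nat) = 1 by exists (u' * u); rewrite -mulrA.
move=> j; have M0 : M%:Z != 0 by rewrite eqz_nat -lt0n.
have jM : (`|(j %% M%:Z)%Z| < M)%N by rewrite -ltz_nat gez0_abs ?modz_ge0 // ltz_pmod.
have -> : v j = v (Ordinal jM : nat).
  by apply: hp => /=; rewrite gez0_abs ?modz_ge0 // modz_mod.
exists (d0 * \prod_(i < M | i != Ordinal jM) v (i : nat)).
by rewrite -mulrA [X in _ * X]mulrC -[RHS]d0P [in RHS](bigD1 (Ordinal jM)).
Qed.

Lemma kummer_data_units (D : comNzRingType) (e : {rmorphism Kb -> D}) u v :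
    (forall i j, (i = j %[mod M%:Z])%Z -> v i = v j) ->
    (forall j, v j ^+ N = 1 - e (w_ ^ j) * u) ->
    (exists d, d * u = 1) -> (forall j, exists d, d * v j = 1) ->
  exists u', kummer_data e u v u'.
Proof.
move=> hp hr [d du] /choice[f fP]; exists (d * \prod_(j < M) f (j : nat)); split=> //.
by rewrite mulrACA du mul1r -big_split big1 => //= j _; exact: fP.
Qed.

Lemma kummer_over_V : alg_over_V n kt.
Proof.
have kd := kummer_alg_data; have [_ _ hi] := kd.
exists (kinv ^+ N); rewrite -exprM mulnC -(kummer_prod kd) -!exprMn.
by rewrite hi expr1n.
Qed.

(** The generators x and y_j are N-th roots of units and N is invertible, so each lifts uniquely
    along a square-zero extension. *)
Lemma kummer_formally_etale : formally_etale kt.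
Proof.
move=> C D q f c q_surj q_sqz qc.
have fP := lrmorph_hom_over f.
have [hp hr hi] := kummer_hom_data fP.
have N_inv : ((N%:R)^-1 : Kb)%:A * N%:R = 1 :> C.
  rewrite -scalerAl mul1r -scaler_nat scalerA mulVf ?scale1r //.
  by rewrite Kbar_natr_eq0 -lt0n.
have [fx_unit fy_unit] := kummer_units (kummer_hom_data fP); rewrite /= in fy_unit.
have [U UN qU] : exists2 U, U ^+ N = c & q U = f kx.
  by apply: (sqz_root q_surj q_sqz N_inv N_gt0 fx_unit); apply: (etrans qc); rewrite rmorphXn.
have /choice[V VP] : forall j, exists V, V ^+ N = 1 - (w_ ^ j)%:A * U /\ q V = f (ky j).
  move=> j; have [V V1 V2] : exists2 V, V ^+ N = 1 - (w_ ^ j)%:A * U & q V = f (ky j).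
    apply: (sqz_root q_surj q_sqz N_inv N_gt0 (fy_unit j)).
    rewrite [RHS]hr rmorphB rmorph1 mulr_algl -qU; congr (1 - _).
    exact: (hom_overZ (lrmorph_hom_over q)).
  by exists V.
have [W WP] : exists W, W * (U * \prod_(j < M) V (j : nat)) = 1.
  apply: (sqz_unit q_surj q_sqz); exists (f kinv).
  have qP := lrmorph_hom_over q.
  rewrite -hi; congr (_ * _); apply: (etrans (qP.2.2 _ _)); congr (_ * _); first exact: qU.
  by apply: (etrans (hom_over_prod qP _)); apply: eq_bigr => j _; exact: (VP j).2.
have [g [gx gy]] : exists g : {lrmorphism kummer_alg -> C}, g kx = U /\ forall j, g (ky j) = V j.
  (* The lifts V_j were chosen independently; uniqueness of lifted roots makes them periodic in
     j. *)
  apply: (@kummer_lift _ _ _ W); split=> // [i j ij|j]; last exact: (VP j).1.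
  have [Vi qi] := VP i; have [Vj qj] := VP j.
  apply: (sqz_root_uniq q_surj q_sqz N_inv).
  - by have [d du] := fy_unit i; exists d; rewrite -du; congr (_ * _); exact: qi.
  - by apply: (etrans qi); apply: (etrans _ (esym qj)); exact: hp.
  - apply: (etrans Vi); apply: (etrans _ (esym Vj)).
    by move/eqP: ij; rewrite -(eq_unity_exprz w_prim) => /eqP ->.
exists g; split.
- apply: (etrans (hom_overX (lrmorph_hom_over g) kx N)); rewrite -UN.
  by congr (_ ^+ _); exact: gx.
- apply: (kummer_lr_uniq (f := q \o g)) => [|j] /=.
    by apply: (etrans (congr1 q gx)); exact: qU.
  by apply: (etrans (congr1 q (gy j))); exact: (VP j).2.
move=> g' g't g'f; have g'x : g' kx = U.
  apply: (sqz_root_uniq q_surj q_sqz N_inv).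
  - by have [d du] := fx_unit; exists d; rewrite -du; congr (_ * _); exact: g'f.
  - by apply: (etrans _ (esym qU)); exact: g'f.
  - rewrite UN -g't; exact: esym (hom_overX (lrmorph_hom_over g') kx N).
have [_ hr' _] := kummer_hom_data (lrmorph_hom_over g').
apply: kummer_lr_uniq => [|j]; first exact: (etrans g'x (esym gx)).
apply: (etrans _ (esym (gy j))); apply: (sqz_root_uniq q_surj q_sqz N_inv).
- by have [d du] := fy_unit j; exists d; rewrite -du; congr (_ * _); exact: g'f.
- by apply: (etrans _ (esym (VP j).2)); exact: g'f.
- by apply: (etrans (hr' j)); apply: (etrans _ (esym (VP j).1)); congr (1 - _ * _); exact: g'x.
Qed.

End KummerCover.

(** * Finiteness of the Kummer covers over V_n *)

Section ModuleFinite.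
Variables (R : realType) (K : divringClosed R[i]).
Local Notation Kb := (Kbar K).
Variables (n N : nat) (n_gt0 : (0 < n)%N) (N_gt0 : (0 < N)%N).
Local Notation M := (n * N)%N.
Local Notation w_ := (zetaK K M).
Local Notation B := (kummer_alg K n_gt0 N_gt0).
Local Notation x_ := (kx K n_gt0 N_gt0).
Local Notation y_ := (ky K n_gt0 N_gt0).
Local Notation t_ := (kt K n_gt0 N_gt0).

Local Notation idx := ('I_N * {ffun 'I_M -> 'I_N})%type.

Definition kmono (p : idx) : B := x_ ^+ p.1 * \prod_(j < M) y_ (j : nat) ^+ p.2 j.

(** The Kb[t]-span of the monomials in x and the y_j with all exponents below N. It is the
    subalgebra generated by x and the y_j; only [kinv] lies outside, up to denominators. *)
Definition kspan (b : B) := exists P : idx -> {poly Kb},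
  b = \sum_p horner_alg t_ (P p) * kmono p.

Lemma kspanD b b' : kspan b -> kspan b' -> kspan (b + b').
Proof.
move=> [P ->] [Q ->]; exists (fun p => P p + Q p).
by rewrite -big_split; apply: eq_bigr => p _; rewrite rmorphD mulrDl.
Qed.

Lemma kspanZt c b : kspan b -> kspan (horner_alg t_ c * b).
Proof.
move=> [P ->]; exists (fun p => c * P p).
by rewrite mulr_sumr; apply: eq_bigr => p _; rewrite rmorphM mulrA.
Qed.

Lemma kspan0 : kspan 0.
Proof. by exists (fun=> 0); rewrite big1 // => p _; rewrite rmorph0 mul0r. Qed.

Lemma kspan_sum (I : Type) (r : seq I) (F : I -> B) :
  (forall i, kspan (F i)) -> kspan (\sum_(i <- r) F i).
Proof.
by move=> FP; elim/big_rec: _ => [|i b _]; [exact: kspan0|exact: kspanD].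
Qed.

Lemma kspan_kmono p : kspan (kmono p).
Proof.
exists (fun q => (q == p)%:R); rewrite (bigD1 p) //= eqxx rmorph1 mul1r.
by rewrite big1 ?addr0 // => q /negbTE ->; rewrite rmorph0 mul0r.
Qed.

(* Powers x^k and y_j^k with k >= N reduce by x^N = t and y_j^N = 1 - w^j x. *)
Lemma kspan_gen (q : {poly Kb}) (E : 'I_M -> nat) :
  kspan (horner_alg x_ q * \prod_(j < M) y_ (j : nat) ^+ E j).
Proof.
have [_ hr _] := kummer_alg_data K n_gt0 N_gt0.
have yE (j : 'I_M) : y_ (j : nat) ^+ E j =
    horner_alg x_ ((1 - (w_ ^ (j : nat))%:P * 'X) ^+ (E j %/ N)) * y_ (j : nat) ^+ (E j %% N).
  rewrite [in LHS](divn_eq (E j) N) exprD (mulnC (E j %/ N)%N) exprM hr; congr (_ * _).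
  rewrite [RHS]rmorphXn; congr (_ ^+ _).
  by rewrite rmorphB rmorph1 rmorphM /= horner_algX horner_algC.
rewrite (eq_bigr _ (fun j _ => yE j)) big_split /= mulrA -rmorph_prod -rmorphM /=.
move: (q * _) => {}q; rewrite -[q]coefK poly_def rmorph_sum /= mulr_suml.
apply: kspan_sum => k; rewrite -mul_polyC rmorphM rmorphXn /= horner_algC horner_algX.
have xE : x_ ^+ k = horner_alg t_ ('X^(k %/ N)) * x_ ^+ (k %% N).
  by rewrite [in LHS](divn_eq k N) exprD [(_ * N)%N]mulnC exprM rmorphXn /= horner_algX.
have -> : (q`_k)%:A * x_ ^+ k * \prod_(j < M) y_ (j : nat) ^+ (E j %% N) =
   horner_alg t_ ((q`_k)%:P * 'X^(k %/ N)) *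
     kmono (Ordinal (ltn_pmod k N_gt0), [ffun j => Ordinal (ltn_pmod (E j) N_gt0)]).
  rewrite xE rmorphM /= horner_algC /kmono /= !mulrA; congr (_ * _).
  by apply: eq_bigr => j _; rewrite ffunE.
exact/kspanZt/kspan_kmono.
Qed.

Lemma kspanM b b' : kspan b -> kspan b' -> kspan (b * b').
Proof.
move=> [P ->] [Q ->]; rewrite mulr_suml; apply: kspan_sum => p.
rewrite mulr_sumr; apply: kspan_sum => p'.
rewrite mulrACA -rmorphM; apply: kspanZt.
rewrite /kmono mulrACA -exprD -big_split.
rewrite (eq_bigr (fun j => y_ (nat_of_ord j) ^+ (p.2 j + p'.2 j))) => [|j _].
  by rewrite -[X in X ^+ (p.1 + p'.1)](horner_algX x_) -rmorphXn; exact: kspan_gen.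
by rewrite exprD.
Qed.

Lemma kspanX b k : kspan b -> kspan (b ^+ k).
Proof.
move=> hb; elim: k => [|k IHk]; last by rewrite exprS; exact: kspanM.
have := kspan_gen 1 (fun=> 0%N).
by rewrite rmorph1 mul1r big1.
Qed.

Lemma kspan_x : kspan x_.
Proof.
have := kspan_gen 'X (fun=> 0%N).
by rewrite horner_algX big1 ?mulr1.
Qed.


Lemma kspan_prod_y : kspan (\prod_(j < M) y_ (j : nat)).
Proof.
have := kspan_gen 1 (fun=> 1%N).
by rewrite rmorph1 mul1r.
Qed.

(** With Y the product of the y_j, t (1 - t^n) = (x Y)^N, and [kinv] is the inverse of x Y. One
    factor t (1 - t^n) therefore turns [kinv] into (x Y)^(N-1). *)
Lemma kspan_clear b : exists k, kspan ((t_ * (1 - t_ ^+ n)) ^+ k * b).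
Proof.
have kd := kummer_alg_data K n_gt0 N_gt0; have [hp _ hi] := kd.
pose Y := \prod_(j < M) y_ (j : nat).
have DE : t_ * (1 - t_ ^+ n) = (x_ * Y) ^+ N.
  by rewrite -exprM mulnC -(kummer_prod n_gt0 N_gt0 kd) -exprMn.
have XY : kspan (x_ * Y) by apply: kspanM; [exact: kspan_x|exact: kspan_prod_y].
have DX k : kspan ((t_ * (1 - t_ ^+ n)) ^+ k) by rewrite DE -exprM; exact: kspanX.
move: b; apply: presented_ind => [a|[|j|]|x y [k hk] [k' hk']|x y [k hk] [k' hk']].
- exists 0%N; rewrite expr0 mul1r.
  have := kspan_gen a%:P (fun=> 0%N).
  by rewrite horner_algC big1 ?mulr1.
- by exists 0%N; rewrite expr0 mul1r; exact: kspan_x.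
- exists 0%N; rewrite expr0 mul1r.
  have M0 : M%:Z != 0 by rewrite eqz_nat -lt0n muln_gt0 n_gt0.
  have jM : (`|(j %% M%:Z)%Z| < M)%N.
    by rewrite -ltz_nat gez0_abs ?modz_ge0 // ltz_pmod // ltz_nat muln_gt0 n_gt0.
  have -> : pgen (kummer_nontriv (K := K) n_gt0 N_gt0) (GenY j) =
      y_ (nat_of_ord (Ordinal jM)).
    by apply: hp => /=; rewrite gez0_abs ?modz_ge0 // modz_mod.
  have := kspan_gen 1 (fun i => (i == Ordinal jM) : nat).
  rewrite rmorph1 mul1r (bigD1 (Ordinal jM)) //= eqxx expr1 big1 ?mulr1 //.
  by move=> i /negbTE ->.
- exists 1%N; rewrite expr1 DE.
  have -> : (x_ * Y) ^+ N = (x_ * Y) ^+ N.-1 * (x_ * Y) by rewrite -exprSr prednK.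
  rewrite -mulrA.
  rewrite -[X in _ * X]/(_ * kinv _ _ _) [X in _ * X]mulrC hi mulr1.
  exact: kspanX.
- exists (k + k')%N; rewrite mulrDr; apply: kspanD; rewrite exprD.
    by rewrite -mulrA mulrCA; apply: kspanM.
  by rewrite -mulrA; apply: kspanM.
- by exists (k + k')%N; rewrite exprD mulrACA; apply: kspanM.
Qed.

Lemma kummer_module_finite : module_finite n t_.
Proof.
exists [seq kmono p | p <- enum {: idx}] => b.
have [k [P bE]] := kspan_clear b; pose p0 : idx := (Ordinal N_gt0, [ffun=> Ordinal N_gt0]).
exists k, (fun i => P (nth p0 (enum {: idx}) i)); rewrite bE.
rewrite -(big_mkord xpredT (fun i => horner_alg t_ (P (nth p0 (enum {: idx}) i)) *
  [seq kmono p | p <- enum {: idx}]`_i)) size_map.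
rewrite -big_enum /= (big_nth p0); apply: eq_big_nat => i /andP[_ iN].
by rewrite (nth_map p0).
Qed.

End ModuleFinite.

(** * The Galois group of the Kummer covers *)

Section Wreath.
Variables (H J : finZmodType) (tau : H -> J).

(* [(i, c)] stands for the automorphism mapping x to w ^ i x and y_j to       *)
(* w ^ c_j y_(j + tau i); this is where the twisted product comes from.       *)
Definition wreath (tauD : {morph tau : a b / a + b}) := (H * {ffun J -> H})%type.

Hypothesis tauD : {morph tau : a b / a + b}.
Local Notation W := (wreath tauD).

HB.instance Definition _ := Finite.on W.

Definition wreath_mul (g h : W) : W :=
  (g.1 + h.1, [ffun j => h.2 j + g.2 (j + tau h.1)]).
Definition wreath_one : W := (0, [ffun=> 0]).
Definition wreath_inv (g : W) : W := (- g.1, [ffun j => - g.2 (j - tau g.1)]).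

Fact wreath_mulA : associative wreath_mul.
Proof.
move=> g h k; congr (_, _); first exact: addrA.
by apply/ffunP => j; rewrite !ffunE /= tauD [tau h.1 + _]addrC !addrA.
Qed.
Fact wreath_mul1 : left_id wreath_one wreath_mul.
Proof.
move=> [i c]; congr (_, _); first exact: add0r.
by apply/ffunP => j; rewrite !ffunE addr0.
Qed.
Fact wreath_mulV : left_inverse wreath_one wreath_inv wreath_mul.
Proof.
move=> [i c]; congr (_, _); first exact: addNr.
by apply/ffunP => j; rewrite !ffunE /= addrK subrr.
Qed.
HB.instance Definition _ := Finite_isGroup.Build W wreath_mulA wreath_mul1 wreath_mulV.

End Wreath.

Section Galois.
Variables (R : realType) (K : divringClosed R[i]).
Local Notation Kb := (Kbar K).
Variables (n N : nat) (n_gt0 : (0 < n)%N) (N_gt0 : (0 < N)%N).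
Local Notation M := (n * N)%N.
Local Notation w_ := (zetaK K M).
Local Notation B := (kummer_alg K n_gt0 N_gt0).
Local Notation x_ := (kx K n_gt0 N_gt0).
Local Notation y_ := (ky K n_gt0 N_gt0).
Local Notation t_ := (kt K n_gt0 N_gt0).

Let M_gt0 : (0 < M)%N. Proof. by rewrite muln_gt0 n_gt0. Qed.
Let w_prim : M.-primitive_root w_. Proof. exact: zetaK_prim. Qed.
Let v_prim : N.-primitive_root (zetaK K N). Proof. exact: zetaK_prim. Qed.

(** The residues mod N and mod nN, in successor form so that the ordinals carry their additive group
    structure. *)
Local Notation H := 'I_N.-1.+1.
Local Notation J := 'I_M.-1.+1.

Definition shift (i : H) : J := inZp (n * i).

Fact shiftD : {morph shift : a b / a + b}.
Proof.
move=> a b; apply/val_inj => /=.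
move: (nat_of_ord a) (nat_of_ord b) => {}a {}b; rewrite !prednK // muln_modr.
by rewrite modn_mod modnDm mulnDr.
Qed.

Definition idxJ (j : int) : J := inZp `|(j %% M%:Z)%Z|.

Lemma idxJ_mod j : (idxJ j)%:Z = (j %% M%:Z)%Z.
Proof.
have M0 : M%:Z != 0 by rewrite eqz_nat -lt0n.
rewrite /= prednK // -modz_nat gez0_abs ?modz_ge0 //.
exact: modz_mod.
Qed.

Lemma y_idxJ j : y_ j = y_ (idxJ j).
Proof.
have [hp _ _] := kummer_alg_data K n_gt0 N_gt0.
by apply: hp; rewrite idxJ_mod modz_mod.
Qed.

Lemma idxJ_nat (j : J) : idxJ (j : nat) = j.
Proof.
have jM : (j < M)%N by rewrite -[X in (_ < X)%N](prednK M_gt0).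
apply/val_inj => /=; move: (nat_of_ord j) jM => {}j jM.
by rewrite modz_nat absz_nat !prednK // modn_mod modn_small.
Qed.

Lemma idxJ_shift j (i : H) : idxJ (j + (n * i)%:Z) = idxJ j + shift i.
Proof.
apply/val_inj/eqP; rewrite -eqz_nat idxJ_mod /= -modz_nat !PoszD.
move: (nat_of_ord i) => {}i; rewrite !prednK //.
rewrite -!modz_nat modzDm gez0_abs ?modzDml //.
by rewrite modz_ge0 // eqz_nat -lt0n.
Qed.

Local Notation G := (wreath shiftD).

(** Since zeta_N = w^n, multiplying x by zeta_N^i turns 1 - w^j x into 1 - w^(j + ni) x; y_j may
    then go to y_(j + ni) times any N-th root of unity. *)
Lemma act_ex (g : G) : exists f : {lrmorphism B -> B},
  f x_ = (zetaK K N ^+ g.1) *: x_ /\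
  forall j, f (y_ j) = (zetaK K N ^+ (g.2 (idxJ j))) *: y_ (j + (n * g.1)%:Z).
Proof.
have [hp hr hi] := kummer_alg_data K n_gt0 N_gt0.
have [xU yU] := kummer_units n_gt0 N_gt0 (kummer_alg_data K n_gt0 N_gt0).
pose u : B := zetaK K N ^+ g.1 *: x_.
pose v j : B := zetaK K N ^+ (g.2 (idxJ j)) *: y_ (j + (n * g.1)%:Z).
have zN k : (zetaK K N ^+ k) ^+ N = 1 by rewrite exprAC (prim_expr_order v_prim) expr1n.
have [u' uP] : exists u', kummer_data n N (in_alg B) u v u'.
  apply: kummer_data_units => // [i j ij|j||j].
  - rewrite /v; have -> : idxJ i = idxJ j by apply/val_inj/eqP; rewrite -eqz_nat !idxJ_mod ij.
    by congr (_ *: _); apply: hp; rewrite -modzDml ij modzDml.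
  - rewrite /v exprZn zN scale1r hr /u; congr (1 - _).
    rewrite /= !mulr_algl scalerA; congr (_ *: _).
    apply: (etrans (expfzDr _ _ (unity_neq0 w_prim))); congr (_ * _).
    by rewrite -[LHS]/(w_ ^+ (n * g.1)) exprM zetaK_mul.
  - have [d dx] := xU; exists ((zetaK K N ^+ g.1)^-1 *: d).
    by rewrite -scalerAl -scalerAr dx scalerA mulVf ?scale1r // expf_neq0 // (unity_neq0 v_prim).
  - have [d dy] := yU (j + (n * g.1)%:Z); exists ((zetaK K N ^+ g.2 (idxJ j))^-1 *: d).
    by rewrite -scalerAl -scalerAr dy scalerA mulVf ?scale1r // expf_neq0 // (unity_neq0 v_prim).
by have [f [fx fy]] := @kummer_lift R K n N n_gt0 N_gt0 B u v u' uP; exists f.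
Qed.

(** The group has order N * N^(nN). For two points of one fibre, the ratio of the values of x is an
    N-th root of unity; it fixes the shift of the indices, and the ratios of the values of the y_j
    are then N-th roots of unity too. None of these values vanishes, so the group element is
    unique. *)
Lemma kummer_galois (l : nat) : l.-nat N -> galois_l l n t_.
Proof.
move=> lN; have [act actP] := choice act_ex.
have actx g : act g x_ = (zetaK K N ^+ g.1) *: x_ by have [] := actP g.
have acty g j : act g (y_ j) = (zetaK K N ^+ (g.2 (idxJ j))) *: y_ (j + (n * g.1)%:Z).
  by have [_ ->] := actP g.
have [hp hr hi] := kummer_alg_data K n_gt0 N_gt0.
have zD (a b : H) : zetaK K N ^+ nat_of_ord (a + b)%R = zetaK K N ^+ a * zetaK K N ^+ b.
  rewrite -[nat_of_ord (a + b)%R]/((a + b) %% N.-1.+1)%N.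
  move: (nat_of_ord a) (nat_of_ord b) => {}a {}b.
  by rewrite prednK // (prim_expr_mod v_prim) exprD.
have ltH (a : H) : (a < N)%N by rewrite -[X in (_ < X)%N](prednK N_gt0).
have inj_z (a b : H) : zetaK K N ^+ a = zetaK K N ^+ b -> a = b.
  move/eqP; rewrite (eq_prim_root_expr v_prim) => /eqP ab; apply/val_inj.
  by move: ab; rewrite !modn_small.
exists G, act; split.
- rewrite (card_prod H {ffun J -> H} : #|{: G}| = _) card_ffun !card_ord !prednK //.
  by rewrite pnatM pnatX lN.
- apply: (kummer_lr_uniq (g := idfun)) => [|j].
    by rewrite actx /= expr0 scale1r.
  by rewrite acty /= ffunE expr0 scale1r muln0 addr0.
- move=> g h; apply: (kummer_lr_uniq (g := act g \o act h)) => [|j].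
    rewrite /= !actx linearZ /= actx scalerA; congr (_ *: _).
    by rewrite mulrC; exact: zD.
  rewrite /= !acty linearZ /= acty scalerA ffunE zD idxJ_shift; congr (_ *: _).
  apply: hp; rewrite -addrA -PoszD -mulnDr [(h.1 + g.1)%N]addnC.
  move: (nat_of_ord g.1) (nat_of_ord h.1) => a b.
  by rewrite prednK // muln_modr -modz_nat modzDmr.
- move=> g; apply: (etrans (hom_overX (lrmorph_hom_over (act g)) x_ N)).
  apply: (etrans (congr1 (fun b => b ^+ N) (actx g))).
  by rewrite exprZn exprAC (prim_expr_order v_prim) expr1n scale1r.
move=> z z0 zn; split.
  have [a aN] := @Kbar_root R K N z N_gt0.
  have a0 : a != 0 by apply: contraNneq z0 => a0; rewrite -aN a0 expr0n gtn_eqF.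
  have aM : a ^+ M != 1 by rewrite mulnC exprM aN.
  have [v [u' vP]] := kummer_point n_gt0 N_gt0 a0 aM.
  have [f [fP fx _ _]] := @kummer_hom R K n N n_gt0 N_gt0 Kb idfun a v u' vP.
  exists f; split; [exact: fP.1|exact: fP.2|].
  by rewrite (hom_overX fP) fx.
move=> p p' [p1 p2 pt] [p1' p2' pt'].
have pP : hom_over (idfun : {rmorphism Kb -> Kb}) p by [].
have pP' : hom_over (idfun : {rmorphism Kb -> Kb}) p' by [].
have [_ pr _] := kummer_hom_data pP; have [_ pr' _] := kummer_hom_data pP'.
have ptE : p x_ ^+ N = z by rewrite -(hom_overX pP).
have ptE' : p' x_ ^+ N = z by rewrite -(hom_overX pP').
have px0 : p x_ != 0 by apply: contraNneq z0 => h; rewrite -ptE h expr0n gtn_eqF.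
have pxM : p x_ ^+ M != 1 by rewrite mulnC exprM ptE.
have py0 j : p (y_ j) != 0.
  apply: contraTneq (kummer_one_sub_neq0 n_gt0 N_gt0 j pxM) => h.
  by have := pr j; rewrite /= h expr0n gtn_eqF // => <-; rewrite eqxx.
have root_ratio (a b : Kb) : b != 0 -> a ^+ N = b ^+ N -> exists c : H, a = zetaK K N ^+ c * b.
  move=> b0 ab; have : (a / b) ^+ N = 1 by rewrite expr_div_n ab divff // expf_neq0.
  move/(prim_rootP v_prim) => [i iE].
  have iN : (i < N.-1.+1)%N by rewrite prednK.
  by exists (Ordinal iN); rewrite /= -iE divfK.
have [i iE] : exists c : H, p' x_ = zetaK K N ^+ c * p x_.
  by apply: root_ratio; rewrite ?ptE ?ptE'.
have [c cE] : exists c : {ffun J -> H}, forall j : J,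
    p' (y_ (j : nat)) = zetaK K N ^+ (c j) * p (y_ ((j : nat)%:Z + (n * i)%:Z)).
  suff /fin_all_exists[c cP] : forall j : J, exists c : H,
      p' (y_ (j : nat)) = zetaK K N ^+ c * p (y_ ((j : nat)%:Z + (n * i)%:Z)).
    by exists (finfun c) => j; rewrite ffunE.
  move=> j; apply: root_ratio => //; apply: (etrans (pr' _)); apply: (etrans _ (esym (pr _))).
  rewrite iE mulrA; congr (1 - _ * _); rewrite (expfzDr _ _ (unity_neq0 w_prim)).
  by rewrite -[w_ ^ (n * i)%:Z]/(w_ ^+ (n * i)) exprM zetaK_mul.
have actp (g : G) : hom_over (idfun : {rmorphism Kb -> Kb}) (p \o act g).
  split; first by move=> a b1 b2; rewrite /= linearP p1.
  by split=> [|b1 b2] /=; rewrite ?rmorph1 ?p2.1 // rmorphM p2.2.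
exists (i, c); split.
  apply/funext; apply: (kummer_hom_uniq pP' (actp _)) => [|j] /=.
    by rewrite actx (hom_overZ pP).
  rewrite acty (hom_overZ pP) [in LHS]y_idxJ cE; congr (_ * p _).
  by apply: hp; rewrite idxJ_mod modzDml.
move=> [i' c'] p'E.
have ii : i = i'.
  apply: inj_z; apply: (mulIf px0); rewrite -iE p'E /= actx.
  exact: (hom_overZ pP).
subst i'; congr (_, _); apply/ffunP => j; apply: inj_z.
apply: (mulIf (py0 ((j : nat)%:Z + (n * i)%:Z))); rewrite -cE p'E /= acty idxJ_nat.
exact: (hom_overZ pP).
Qed.

End Galois.

(** * Principal roots and uniqueness of continuous roots *)

Section ComplexLimits.
Import numFieldNormedType.Exports.
Local Open Scope classical_set_scope.
Variable R : realType.
Local Notation C := (R[i]^o).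
Local Notation Re := (@complex.Re R).
Local Notation Im := (@complex.Im R).
Local Open Scope complex_scope.

Definition normsq (z : R[i]) : R := Re z ^+ 2 + Im z ^+ 2.

Lemma normsqM z w : normsq (z * w) = normsq z * normsq w.
Proof. by case: z => a b; case: w => c d; rewrite /normsq /=; ring. Qed.

Lemma normsq_gt0 z : z != 0 -> 0 < normsq z.
Proof.
case: z => a b z0; rewrite /normsq /= lt_neqAle addr_ge0 ?sqr_ge0 // andbT eq_sym.
by rewrite paddr_eq0 ?sqr_ge0 // !sqrf_eq0; move: z0; rewrite eq_complex.
Qed.

Lemma normc_ge_Im (z : R[i]) : `|Im z|%:C <= `|z|.
Proof.
by rewrite normc_def lecR -sqrtr_sqr ler_wsqrtr // lerDr sqr_ge0.
Qed.

Lemma normc_le_ReIm (z : R[i]) : `|z| <= (`|Re z| + `|Im z|)%:C.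
Proof.
rewrite normc_def lecR -[leRHS]ger0_norm ?addr_ge0 // -sqrtr_sqr ler_wsqrtr //.
rewrite sqrrD !real_normK ?num_real // -addrA lerD2l lerDr.
by rewrite mulrn_wge0 // mulr_ge0.
Qed.

(** Convergence by components, which reduces complex limits to real ones; [cvgcP] relates it to the
    topology of [R[i]]. *)
Definition cvgc (T : Type) (F : set_system T) (f : T -> R[i]) (l : R[i]) :=
  (fun x => Re (f x)) @ F --> Re l /\ (fun x => Im (f x)) @ F --> Im l.

Let ReB (z w : R[i]) : Re z - Re w = Re (z - w). Proof. by case: z; case: w. Qed.
Let ImB (z w : R[i]) : Im z - Im w = Im (z - w). Proof. by case: z; case: w. Qed.
Let ReD (z w : R[i]) : Re (z + w) = Re z + Re w. Proof. by case: z; case: w. Qed.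
Let ImD (z w : R[i]) : Im (z + w) = Im z + Im w. Proof. by case: z; case: w. Qed.
Let ReM (z w : R[i]) : Re (z * w) = Re z * Re w - Im z * Im w.
Proof. by case: z; case: w. Qed.
Let ImM (z w : R[i]) : Im (z * w) = Re z * Im w + Im z * Re w.
Proof. by case: z; case: w. Qed.

Section Filter.
Variables (T : Type) (F : set_system T).
Context {FF : Filter F}.
Implicit Types f g : T -> R[i].

Lemma cvgcP f (l : R[i]) : cvgc F f l <-> (f : T -> R[i]^o) @ F --> (l : R[i]^o).
Proof.
split=> [[fr fi]|fl].
  apply/cvgrPdist_lt => e; rewrite ltcE => /andP[/eqP e0 e1] /=.
  rewrite /= in e0 e1; have e2 : 0 < Re e / 2 by rewrite divr_gt0.
  have eE : e = (Re e)%:C by case: e e0 {e1 e2} => ? ? /= ->.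
  move/cvgrPdist_lt : fr => /(_ _ e2) fr; move/cvgrPdist_lt : fi => /(_ _ e2) fi.
  apply: filterS2 fr fi => x; rewrite ReB ImB => xr xi.
  by apply: le_lt_trans (normc_le_ReIm _) _; rewrite eE ltcR [ltRHS]splitr ltrD.
split; apply/cvgrPdist_lt => e e0.
  have e0' : 0 < e%:C by rewrite ltcR.
  move/cvgrPdist_lt : fl => /(_ _ e0'); apply: filterS => x lx.
  by rewrite -ltcR ReB; apply: le_lt_trans lx; exact: normc_ge_Re.
have e0' : 0 < e%:C by rewrite ltcR.
move/cvgrPdist_lt : fl => /(_ _ e0'); apply: filterS => x lx.
by rewrite -ltcR ImB; apply: le_lt_trans lx; exact: normc_ge_Im.
Qed.

Lemma cvgc_cst a : cvgc F (fun=> a) a.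
Proof. by split; exact: cvg_cst. Qed.

Lemma cvgc_real (f : T -> R) (a : R) : f @ F --> a -> cvgc F (fun x => (f x)%:C) a%:C.
Proof. by move=> fa; split=> //=; exact: cvg_cst. Qed.

Lemma cvgc_add f g a b : cvgc F f a -> cvgc F g b -> cvgc F (fun x => f x + g x) (a + b).
Proof.
move=> [fr fi] [gr gi]; split; rewrite (ReD, ImD).
  by under eq_fun do rewrite ReD; exact: cvgD.
by under eq_fun do rewrite ImD; exact: cvgD.
Qed.

Lemma cvgc_mul f g a b : cvgc F f a -> cvgc F g b -> cvgc F (fun x => f x * g x) (a * b).
Proof.
move=> [fr fi] [gr gi]; split; rewrite (ReM, ImM).
  by under eq_fun do rewrite ReM; apply: cvgB; exact: cvgM.
by under eq_fun do rewrite ImM; apply: cvgD; exact: cvgM.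
Qed.

Lemma cvgc_exp f a k : cvgc F f a -> cvgc F (fun x => f x ^+ k) (a ^+ k).
Proof.
move=> fa; elim: k => [|k IHk]; first exact: cvgc_cst.
by rewrite exprS; under eq_fun do rewrite exprS; exact: cvgc_mul.
Qed.

Lemma cvgc_sum (I : Type) (r : seq I) (f : I -> T -> R[i]) (a : I -> R[i]) :
  (forall i, cvgc F (f i) (a i)) ->
  cvgc F (fun x => \sum_(i <- r) f i x) (\sum_(i <- r) a i).
Proof.
move=> fa; elim: r => [|i r IHr].
  by rewrite big_nil; under eq_fun do rewrite big_nil; exact: cvgc_cst.
by rewrite big_cons; under eq_fun do rewrite big_cons; exact: cvgc_add.
Qed.

Lemma cvgc_prod (I : Type) (r : seq I) (f : I -> T -> R[i]) (a : I -> R[i]) :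
  (forall i, cvgc F (f i) (a i)) ->
  cvgc F (fun x => \prod_(i <- r) f i x) (\prod_(i <- r) a i).
Proof.
move=> fa; elim: r => [|i r IHr].
  by rewrite big_nil; under eq_fun do rewrite big_nil; exact: cvgc_cst.
by rewrite big_cons; under eq_fun do rewrite big_cons; exact: cvgc_mul.
Qed.

Lemma cvgc_normsq f a : cvgc F f a -> (fun x => normsq (f x)) @ F --> normsq a.
Proof.
move=> [fr fi]; rewrite /normsq expr2 [Im a ^+ 2]expr2.
under eq_fun do rewrite expr2 [Im _ ^+ 2]expr2.
by apply: cvgD; exact: cvgM.
Qed.

Lemma cvgc_inv f a : a != 0 -> cvgc F f a -> cvgc F (fun x => (f x)^-1) a^-1.
Proof.
move=> a0 fa; have ReV (z : R[i]) : Re z^-1 = Re z / normsq z by case: z.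
have ImV (z : R[i]) : Im z^-1 = - (Im z / normsq z) by case: z.
have na : normsq a != 0 by rewrite gt_eqF // normsq_gt0.
have nV : (fun x => (normsq (f x))^-1) @ F --> (normsq a)^-1.
  by apply: cvgV => //; exact: cvgc_normsq.
case: fa => fr fi; split; rewrite (ReV, ImV).
  by under eq_fun do rewrite ReV; exact: cvgM.
by under eq_fun do rewrite ImV; apply: cvgN; exact: cvgM.
Qed.

End Filter.

(* The sum s of the f^(N-1-i) g^i is N g^(N-1) where f = g and vanishes where  *)
(* f <> g, so |s|^2 / |g^(N-1)|^2 is continuous with values in {0, N^2}.       *)
Lemma root_lift_uniq (N : nat) (T : R) (f g : R -> R[i]) : (0 < N)%N -> 0 <= T ->
    {within `[0, T], continuous (f : R -> R[i]^o)} ->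
    {within `[0, T], continuous (g : R -> R[i]^o)} ->
    (forall x, 0 <= x <= T -> f x ^+ N = g x ^+ N) ->
    (forall x, 0 <= x <= T -> g x != 0) -> f 0 = g 0 -> f T = g T.
Proof.
move=> N0 T0 fc gc fg g0 fg0; apply/eqP; apply/negP => /negP fgT.
pose s x : R[i] := \sum_(i < N) f x ^+ (N.-1 - i) * g x ^+ i.
pose h x : R := normsq (s x) / normsq (g x ^+ N.-1).
have gN x : 0 <= x <= T -> 0 < normsq (g x ^+ N.-1).
  by move=> xT; apply: normsq_gt0; rewrite expf_neq0 // g0.
have hE x : 0 <= x <= T -> f x = g x -> h x = N%:R ^+ 2.
  move=> xT fgx; rewrite /h /s fgx.
  rewrite (eq_bigr (fun=> g x ^+ N.-1)) => [|i _]; last first.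
    by rewrite -exprD subnK // -ltnS prednK.
  rewrite sumr_const card_ord -[_ *+ N]mulr_natl normsqM mulfK ?gt_eqF ?gN //.
  by rewrite -(rmorph_nat (real_complex R)) /normsq /= expr0n addr0.
have h0 x : 0 <= x <= T -> f x != g x -> h x = 0.
  move=> xT fgx; have := subrXX (f x) (g x) N; rewrite fg // subrr.
  move/esym/eqP; rewrite mulf_eq0 subr_eq0 (negbTE fgx) /= => /eqP sx.
  rewrite /h; have -> : s x = 0.
    exact: sx.
  by rewrite /normsq /= expr0n addr0 mul0r.
have hc : {within `[0, T], continuous h}.
  apply/subspace_continuousP => x; rewrite /= in_itv /= => xT.
  have xA : (`[0, T] : set R) x by rewrite /= in_itv.
  move/subspace_continuousP: (fc) => /(_ x xA) /cvgcP fx.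
  move/subspace_continuousP: (gc) => /(_ x xA) /cvgcP gx.
  apply: cvgM.
    apply: cvgc_normsq; apply: cvgc_sum => i.
    by apply: cvgc_mul; apply: cvgc_exp.
  apply: cvgV; first by rewrite gt_eqF // gN.
  by apply: cvgc_normsq; apply: cvgc_exp.
have T_T : 0 <= T <= T by rewrite T0 lexx.
have z_T : (0 : R) <= 0 <= T by rewrite T0 lexx.
have N0' : 0 < N%:R ^+ 2 :> R by rewrite exprn_gt0 // ltr0n.
(* [h] is N^2 at 0 and 0 at T, so it would take the value N^2 / 2, which is neither 0 nor N^2. *)
have [|c] := IVT (v := N%:R ^+ 2 / 2) T0 hc.
  rewrite (h0 T) // (hE 0) //; apply/andP; split.
    by rewrite ge_min divr_ge0 ?orbT ?ltW.
  by rewrite le_max ler_pdivrMr // ler_pMr // ler1n.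
rewrite in_itv /= => cT hcE.
have [fgc|fgc] := eqVneq (f c) (g c).
  by move: hcE; rewrite hE // => /eqP; rewrite eq_sym; lra.
by move: hcE; rewrite h0 //; lra.
Qed.

Lemma root_lift_eq (N : nat) (T : R) (f g : R -> R[i]) : (0 < N)%N ->
    {within `[0, T], continuous (f : R -> R[i]^o)} ->
    {within `[0, T], continuous (g : R -> R[i]^o)} ->
    (forall x, 0 <= x <= T -> f x ^+ N = g x ^+ N) ->
    (forall x, 0 <= x <= T -> g x != 0) -> f 0 = g 0 ->
  forall x, 0 <= x <= T -> f x = g x.
Proof.
move=> N0 fc gc fg g0 fg0 x /andP[x0 xT].
have sub : (`[0, x] : set R) `<=` `[0, T].
  by apply: subset_itvl; rewrite bnd_simp.
have le_T y : 0 <= y <= x -> 0 <= y <= T by move=> /andP[-> /le_trans]; exact.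
by apply: (root_lift_uniq N0 x0 (continuous_subspaceW sub fc) (continuous_subspaceW sub gc));
  auto.
Qed.

Lemma cvgc_near (T : Type) (F : set_system T) {FF : Filter F} (f g : T -> R[i]) l :
  (\forall x \near F, f x = g x) -> cvgc F g l -> cvgc F f l.
Proof.
move=> fg /cvgcP gl; apply/cvgcP; apply: cvg_trans gl; apply: near_eq_cvg.
by apply: filterS fg => x ->.
Qed.

Lemma Re_one_sub_gt0 (w : R[i]) (x : R) : `|w| = 1 -> 0 <= x < 1 -> 0 < Re (1 - w * x%:C).
Proof.
move=> w1 /andP[x0 x1]; rewrite -ReB subr_gt0 /=.
apply: le_lt_trans (ler_norm _) _; apply: le_lt_trans _ x1.
rewrite -lecR; apply: le_trans (normc_ge_Re _) _.
by rewrite normrM w1 mul1r normc_def /= expr0n addr0 sqrtr_sqr ger0_norm.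
Qed.

Lemma Re_gt0_neq0 (w : R[i]) : 0 < Re w -> w != 0.
Proof. by apply: contraTneq => ->; rewrite ltxx. Qed.

Lemma expi_atan (x : R) : expi (atan x) = (cos (atan x))%:C * (1 +i* x).
Proof.
have c0 : cos (atan x) != 0.
  by apply/lt0r_neq0/cos_gt0_pihalf; rewrite atan_gtNpi2 atan_ltpi2.
have sE : sin (atan x) = cos (atan x) * x.
  by rewrite -[X in _ = _ * X](atanK x) /tan mulrCA divff ?mulr1.
by rewrite /expi sE; apply/eqP; rewrite eq_complex /=; apply/andP; split; apply/eqP; ring.
Qed.

(* The principal N-th root, for [0 < Re w] only: the arctangent is not the     *)
(* argument of [w] outside the right half-plane.                               *)
Definition proot (N : nat) (w : R[i]) : R[i] :=
  (expR (ln (normsq w) / 2 / N%:R))%:C * expi (atan (Im w / Re w) / N%:R).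

Lemma prootK N w : (0 < N)%N -> 0 < Re w -> proot N w ^+ N = w.
Proof.
move=> N0 w0; have N0' : N%:R != 0 :> R by rewrite pnatr_eq0 -lt0n.
rewrite /proot exprMn -rmorphXn -expRM_natl [N%:R * _]mulrC divfK // expiX.
rewrite -(mulr_natr (_ / _)) divfK // expi_atan mulrCA mulrC.
case: w w0 => a b /= a0; set c := cos _; set E := expR _.
have c0 : 0 < c by apply: cos_gt0_pihalf; rewrite atan_gtNpi2 atan_ltpi2.
have wn : 0 < normsq (a +i* b).
  by apply: normsq_gt0; rewrite eq_complex /= negb_and gt_eqF.
have c2 : c ^+ 2 = (1 + (b / a) ^+ 2)^-1.
  by rewrite /c cos_atan exprVn sqr_sqrtr // addr_ge0 ?ler01 ?sqr_ge0.
have E2 : E ^+ 2 = a ^+ 2 + b ^+ 2.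
  by rewrite /E -expRM_natl mulrC divfK ?pnatr_eq0 // lnK.
(* [E] is the modulus and [c] the cosine of the argument; both sides are nonnegative, so comparing
   squares suffices. *)
have Ec : E * c = a.
  apply/eqP; rewrite -(@eqrXn2 _ 2) ?mulr_ge0 ?expR_ge0 ?ltW //.
  rewrite exprMn E2 c2; apply/eqP; field.
  by rewrite gt_eqF //= gt_eqF // addr_gt0 ?exprn_gt0 // ?sqr_ge0.
rewrite mulrAC; have -> : E%:C * c%:C = a%:C by rewrite -Ec -rmorphM.
apply/eqP; rewrite eq_complex /= !mul0r addr0 subr0 mulr1 eqxx /=.
by rewrite mulrCA divff ?mulr1 // gt_eqF.
Qed.

Lemma proot_neq0 N w : (0 < N)%N -> 0 < Re w -> proot N w != 0.
Proof.
move=> N0 w0; apply: contraTneq (Re_gt0_neq0 w0) => p0.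
by rewrite -(prootK N0 w0) p0 expr0n gtn_eqF // eqxx.
Qed.

Lemma proot1 N : proot N 1 = 1.
Proof.
rewrite /proot /normsq /= expr0n expr1n addr0 ln1 !mul0r expR0 atan0 mul0r.
by rewrite /expi cos0 sin0 mulr1.
Qed.

Lemma cvgc_proot (T : Type) (F : set_system T) {FF : Filter F} (N : nat)
    (f : T -> R[i]) (l : R[i]) :
  0 < Re l -> cvgc F f l -> cvgc F (fun x => proot N (f x)) (proot N l).
Proof.
move=> l0 fl; have ln0 : 0 < normsq l.
  by apply: normsq_gt0; apply: contraTneq l0 => ->; rewrite ltxx.
have arg : (fun x => atan (Im (f x) / Re (f x)) / N%:R) @ F --> atan (Im l / Re l) / N%:R.
  apply: cvgMl; apply: continuous_cvg; first exact: continuous_atan.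
  by apply: cvgM; [exact: fl.2|apply: cvgV; [rewrite gt_eqF|exact: fl.1]].
apply: cvgc_mul.
  apply: cvgc_real; apply: continuous_cvg; first exact: continuous_expR.
  do 2!apply: cvgMl; apply: continuous_cvg; first exact: continuous_ln.
  exact: cvgc_normsq.
split=> /=.
  by apply: continuous_cvg; [exact: continuous_cos|exact: arg].
by apply: continuous_cvg; [exact: continuous_sin|exact: arg].
Qed.

Lemma continuous_powRl (p r : R) : 0 < r -> {for r, continuous (fun x => x `^ p)}.
Proof.
move=> r0; rewrite /prop_for /continuous_at /powR (gt_eqF r0).
have h : (fun x => expR (p * ln x)) @ r --> expR (p * ln r).
  apply: continuous_cvg; first exact: continuous_expR.
  by apply: cvgMr; exact: (continuous_ln r0).
apply: cvg_trans h; apply: near_eq_cvg; near=> x; rewrite ifF //.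
apply/negbTE; rewrite gt_eqF //; near: x; exact: lt_nbhsr.
Unshelve. all: by end_near.
Qed.

End ComplexLimits.

(** * Sections over ]0, 1[ and transport along paths *)

Section StandardSection.
Import numFieldNormedType.Exports.
Local Open Scope classical_set_scope.
Variables (R : realType) (K : divringClosed R[i]).
Local Notation Kb := (Kbar K).
Local Notation kv := (val : {rmorphism Kb -> R[i]}).

Lemma mem01 (r : R) : (r \in (`]0, 1[ : set R)) = (0 < r < 1).
Proof. by apply/idP/idP; rewrite inE /= in_itv. Qed.

Lemma norm_zeta N (j : int) : (0 < N)%N -> `|kval (zetaK K N ^ j)| = 1.
Proof.
move=> N0; have w1 : `|kval (zetaK K N ^ j)| ^+ N = 1.
  rewrite -normrX -[kval _]/(kv _) -rmorphXn.
  have -> : (zetaK K N ^ j) ^+ N = 1.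
    by rewrite -[LHS]/((zetaK K N ^ j) ^ N%:Z) exprzAC
      [_ ^ N%:Z](prim_expr_order (zetaK_prim K N0)) exp1rz.
  by rewrite rmorph1 normr1.
by apply/eqP; rewrite -(pexpr_eq1 N0) // w1.
Qed.

Lemma Re_kummer_gt0 N (j : int) (x : R) : (0 < N)%N -> 0 <= x < 1 ->
  0 < complex.Re (1 - kval (zetaK K N ^ j) * (x%:C)%C).
Proof. by move=> N0; apply: Re_one_sub_gt0; rewrite norm_zeta. Qed.

Variables (n N : nat) (n_gt0 : (0 < n)%N) (N_gt0 : (0 < N)%N).
Local Notation M := (n * N)%N.
Local Notation B := (kummer_alg K n_gt0 N_gt0).
Local Notation x_ := (kx K n_gt0 N_gt0).
Local Notation y_ := (ky K n_gt0 N_gt0).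
Local Notation t_ := (kt K n_gt0 N_gt0).

Let M_gt0 : (0 < M)%N. Proof. by rewrite muln_gt0 n_gt0. Qed.

Definition real_root (r : R) : R := r `^ (N%:R^-1).

Lemma real_rootK r : 0 < r -> real_root r ^+ N = r.
Proof.
move=> r0; rewrite -powR_mulrn ?powR_ge0 // -powRrM mulVf ?powRr1 ?ltW //.
by rewrite pnatr_eq0 -lt0n.
Qed.

Lemma real_root_gt0 r : 0 < r -> 0 < real_root r.
Proof. exact: powR_gt0. Qed.

Lemma real_root01 r : 0 < r < 1 -> 0 <= real_root r < 1.
Proof.
move=> /andP[r0 r1]; rewrite powR_ge0 /= ltNge; apply/negP => h.
by move: r1; rewrite ltNge -(real_rootK r0) exprn_ege1.
Qed.

(** On ]0, 1[ the radicand stays in the right half-plane, where [proot] is continuous, and it tends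
    to 1 at 0: this is the branch prescribed at the tangential base point. *)
Definition standard_y (r : R) (j : int) : R[i] :=
  proot N (1 - kval (zetaK K M ^ j) * ((real_root r)%:C)%C).

Lemma standard_hom r : 0 < r < 1 -> exists f : B -> R[i],
  [/\ hom_over kv f, f x_ = ((real_root r)%:C)%C & forall j, f (y_ j) = standard_y r j].
Proof.
move=> r01; have [r0 r1] := andP r01; have x01 := real_root01 r01.
have w_prim : M.-primitive_root (zetaK K M) by exact: zetaK_prim.
have [u' uP] : exists u', kummer_data n N kv (((real_root r)%:C)%C : R[i]) (standard_y r) u'.
  apply: kummer_data_units => [i j /eqP ij|j||j].
  - by rewrite /standard_y; move: ij; rewrite -(eq_unity_exprz w_prim) => /eqP ->.
  - by rewrite prootK // Re_kummer_gt0.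
  - exists (((real_root r)%:C)%C)^-1; rewrite mulVf //.
    by rewrite fmorph_eq0 gt_eqF // real_root_gt0.
  - by exists (standard_y r j)^-1; rewrite mulVf // proot_neq0 // Re_kummer_gt0.
have [f [fP fx fy _]] := kummer_hom n_gt0 N_gt0 uP.
by exists f.
Qed.

Lemma cvgc_real_root (r : R) : 0 < r ->
  cvgc (nbhs r) (fun x => ((real_root x)%:C)%C) ((real_root r)%:C)%C.
Proof. by move=> r0; apply: cvgc_real; exact: continuous_powRl. Qed.

Lemma cvgc_kummer_root (T : Type) (F : set_system T) {FF : Filter F} (w : R[i])
    (f : T -> R[i]) (a : R[i]) :
  0 < complex.Re (1 - w * a) -> cvgc F f a ->
  cvgc F (fun x => proot N (1 - w * f x)) (proot N (1 - w * a)).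
Proof.
move=> h fa; apply: cvgc_proot => //; rewrite -mulNr.
under eq_fun do rewrite -mulNr.
by apply: cvgc_add; [exact: cvgc_cst|apply: cvgc_mul => //; exact: cvgc_cst].
Qed.

Lemma cvgc_standard_y (r : R) j : 0 < r < 1 ->
  cvgc (nbhs r) (fun x => standard_y x j) (standard_y r j).
Proof.
move=> r01; apply: cvgc_kummer_root; first by rewrite Re_kummer_gt0 // real_root01.
by apply: cvgc_real_root; case/andP: r01.
Qed.

Lemma standard_section : exists y : R -> B -> R[i], is_section t_ 1 y /\
  forall r, 0 < r < 1 ->
    y r x_ = ((real_root r)%:C)%C /\ forall j, y r (y_ j) = standard_y r j.
Proof.
have /choice[y yP] : forall r : R, exists f : B -> R[i],
    (0 < r < 1 -> [/\ hom_over kv f, f x_ = ((real_root r)%:C)%C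
       & forall j, f (y_ j) = standard_y r j]) /\
    (~~ (0 < r < 1) -> forall b, f b = 0).
  move=> r; have [r01|r01] := boolP (0 < r < 1).
    by have [f fP] := standard_hom r01; exists f.
  by exists (fun=> 0); split.
have yh r : 0 < r < 1 -> hom_over kv (y r) by move=> /(yP r).1[].
have yx r : 0 < r < 1 -> y r x_ = ((real_root r)%:C)%C by move=> /(yP r).1[].
have yy r j : 0 < r < 1 -> y r (y_ j) = standard_y r j by move=> /(yP r).1[_ _].
have y0 r b : ~~ (0 < r < 1) -> y r b = 0 by move=> /(yP r).2.
exists y; split; last by move=> r r01; split=> [|j]; [exact: yx|exact: yy].
split=> [r||r].
- rewrite mem01 => r01; split; first exact: yh.
  rewrite (hom_overX (yh _ r01)) yx // -rmorphXn real_rootK ?mulr1 //.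
  by case/andP: r01.
- move=> b r; rewrite mem01 => r01; apply/cvgcP.
  have near01 : \forall x \near r, 0 < x < 1.
    by apply: near_in_itvoo; rewrite in_itv.
  move: b; apply: presented_ind => [a|[|j|]|b c bc cc|b c bc cc].
  + rewrite (hom_overZ (yh _ r01)) (yh _ r01).2.1.
    apply: (cvgc_near (g := fun=> kv a * 1)); last exact: cvgc_cst.
    by apply: filterS near01 => x x01; rewrite (hom_overZ (yh _ x01)) (yh _ x01).2.1.
  + rewrite yx //; apply: (cvgc_near (g := fun x => ((real_root x)%:C)%C)).
      by apply: filterS near01 => x x01; rewrite yx.
    by apply: cvgc_real_root; case/andP: r01.
  + rewrite yy //; apply: (cvgc_near (g := fun x => standard_y x j)).
      by apply: filterS near01 => x x01; rewrite yy.
    exact: cvgc_standard_y.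
  (* The value of [kinv] is the inverse of the nowhere vanishing continuous function [q]. *)
  + pose q x := ((real_root x)%:C)%C * \prod_(j < M) standard_y x (j : nat).
    have invE x : 0 < x < 1 -> y x (kinv K n_gt0 N_gt0) * q x = 1.
      move=> x01; have [_ _ <-] := kummer_hom_data (yh _ x01).
      by rewrite yx //; congr (_ * (_ * _)); apply: eq_bigr => j _; rewrite /= yy.
    have q0 x : 0 < x < 1 -> q x != 0.
      move=> /invE h; apply: contra_eq_neq h => ->.
      by rewrite mulr0 eq_sym oner_eq0.
    have invE' x : 0 < x < 1 -> y x (kinv K n_gt0 N_gt0) = (q x)^-1.
      by move=> x01; rewrite -[LHS]mulr1 -(divff (q0 _ x01)) mulrA invE // mul1r.
    rewrite [y r _]invE' //; apply: (cvgc_near (g := fun x => (q x)^-1)).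
      by apply: filterS near01 => x x01; rewrite [LHS]invE'.
    apply: cvgc_inv; first exact: q0.
    apply: cvgc_mul; first by apply: cvgc_real_root; case/andP: r01.
    by apply: cvgc_prod => j; exact: cvgc_standard_y.
  + rewrite (hom_overD (yh _ r01)); apply: (cvgc_near (g := fun x => y x b + y x c)).
      by apply: filterS near01 => x x01; rewrite (hom_overD (yh _ x01)).
    exact: cvgc_add.
  + rewrite (yh _ r01).2.2; apply: (cvgc_near (g := fun x => y x b * y x c)).
      by apply: filterS near01 => x x01; rewrite (yh _ x01).2.2.
    exact: cvgc_mul.
- by rewrite mem01 => /y0.
Qed.

Variables (l : nat) (lN : l.-nat N).

Definition kummer_cover : lcover K l n :=
  Cover (kummer_over_V K n_gt0 N_gt0) (kummer_module_finite K n_gt0 N_gt0)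
    (@kummer_formally_etale R K n N n_gt0 N_gt0) (kummer_galois K n_gt0 N_gt0 lN).

Lemma standard_fibre : exists y : fibre (Tangential K 1) kummer_cover,
  forall r, 0 < r < 1 ->
    sect y r x_ = ((real_root r)%:C)%C /\ forall j, sect y r (y_ j) = standard_y r j.
Proof. by have [y [yP yE]] := standard_section; exists (exist _ y yP). Qed.

End StandardSection.

(* [a] is invertible mod [e], so i |-> a i + k permutes the residues. *)
Lemma big_affine (T : Type) (idx : T) (op : Monoid.com_law idx) (e : nat)
    (a b k : int) (h : int -> T) :
    (0 < e)%N -> (a * b = 1 %[mod e%:Z])%Z ->
    (forall i j, (i = j %[mod e%:Z])%Z -> h i = h j) ->
  \big[op/idx]_(i < e) h (a * (i : nat)%:Z + k) = \big[op/idx]_(i < e) h (i : nat).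
Proof.
move=> e0 ab hP; have e0' : e%:Z != 0 by rewrite eqz_nat -lt0n.
have pP (i : 'I_e) : (`|((a * (i : nat)%:Z + k) %% e%:Z)%Z| < e)%N.
  by rewrite -ltz_nat gez0_abs ?modz_ge0 // ltz_pmod.
pose p (i : 'I_e) := Ordinal (pP i).
have pE i : (p i : nat)%:Z = ((a * (i : nat)%:Z + k) %% e%:Z)%Z.
  by rewrite /= gez0_abs ?modz_ge0.
have p_inj : injective p.
  move=> i j pij; have := congr1 (fun x : 'I_e => (x : nat)%:Z) pij; rewrite !pE => h1.
  have h2 : (a * (i : nat)%:Z = a * (j : nat)%:Z %[mod e%:Z])%Z.
    by apply/eqP; rewrite -(eqz_modDr k); apply/eqP.
  have h3 (x : 'I_e) : (b * (a * (x : nat)%:Z) = (x : nat)%:Z %[mod e%:Z])%Z.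
    by rewrite mulrCA mulrA -modzMml ab modzMml mul1r.
  have : ((i : nat)%:Z = (j : nat)%:Z %[mod e%:Z])%Z.
    by rewrite -h3 -[RHS]h3 -modzMmr h2 modzMmr.
  by rewrite !modz_small ?ltz_nat ?ltn_ord // => -[] /val_inj.
rewrite [RHS](reindex_inj p_inj); apply: eq_bigr => i _; apply: hP.
by rewrite pE modz_mod.
Qed.

Lemma eq_modzP (i j d : int) : (i = j %[mod d])%Z <-> exists q, i = j + q * d.
Proof.
split=> [/eqP|[q ->]]; last by rewrite addrC modzMDl.
by rewrite eqz_mod_dvd => /dvdzP[q qE]; exists q; rewrite -qE addrC subrK.
Qed.

Section Roots.
Import numFieldNormedType.Exports.
Local Open Scope classical_set_scope.
Variables (R : realType) (K : divringClosed R[i]).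
Local Notation Kb := (Kbar K).
Local Notation kv := (val : {rmorphism Kb -> R[i]}).

Lemma zetaK_exprz N (i j : int) : (0 < N)%N ->
  zetaK K N ^ (i + j) = zetaK K N ^ i * zetaK K N ^ j.
Proof. by move=> N0; rewrite expfzDr // (unity_neq0 (zetaK_prim K N0)). Qed.

Lemma zetaK_mulz n N (j : int) : (0 < n)%N -> (0 < N)%N ->
  zetaK K (n * N) ^ (n%:Z * j) = zetaK K N ^ j.
Proof. by move=> n0 N0; rewrite -exprz_exp -[_ ^ n%:Z]/(_ ^+ n) zetaK_mul. Qed.

(** Moving the index by M multiplies the root of unity of order eM by zeta_e, so this is
    [prod_one_sub] for the e-th roots of unity. *)
Lemma prod_kummer (D : comNzRingType) (g : {rmorphism Kb -> D}) e M (j : int) (u : D) :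
    (0 < e)%N -> (0 < M)%N ->
  \prod_(i < e) (1 - g (zetaK K (e * M) ^ (j + (i * M)%N%:Z)) * u) =
  1 - g (zetaK K M ^ j) * u ^+ e.
Proof.
move=> e0 M0; have eM0 : (0 < e * M)%N by rewrite muln_gt0 e0.
rewrite (eq_bigr (fun i : 'I_e => 1 - g (zetaK K e ^+ i) * (g (zetaK K (e * M) ^ j) * u))).
  rewrite (prod_one_sub (zetaK_prim K e0)) exprMn -rmorphXn -(zetaK_mulz j e0 M0).
  by rewrite [e%:Z * j]mulrC -exprz_exp.
move=> i _; congr (1 - _); rewrite mulrA -rmorphM; congr (g _ * _).
rewrite zetaK_exprz // mulrC; congr (_ * _).
by rewrite (mulnC i M) (mulnC e M) PoszM zetaK_mulz.
Qed.

(** Principal roots are not multiplicative in general. Here both sides are continuous N-th roots of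
    one function on [0, x], nonzero and equal to 1 at 0, so [root_lift_eq] applies. *)
Lemma proot_pow e f N M (j : int) (x : R) : (0 < e)%N -> (0 < f)%N -> (0 < N)%N -> (0 < M)%N ->
    0 <= x < 1 ->
  proot N (1 - kval (zetaK K M ^ j) * ((x ^+ e)%:C)%C) =
  (\prod_(i < e) proot (f * N) (1 - kval (zetaK K (e * M) ^ (j + (i * M)%N%:Z)) * (x%:C)%C)) ^+ f.
Proof.
move=> e0 f0 N0 M0 /andP[x0 x1]; have eM0 : (0 < e * M)%N by rewrite muln_gt0 e0.
have fN0 : (0 < f * N)%N by rewrite muln_gt0 f0.
have lt1 y : 0 <= y <= x -> 0 <= y < 1 by move=> /andP[-> /le_lt_trans]; exact.
have lt1e y : 0 <= y <= x -> 0 <= y ^+ e < 1.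
  by move=> /lt1/andP[y0 y1]; rewrite exprn_ge0 //= exprn_ilt1 // -lt0n.
have realc (y : R) (F : set_system R) (FF : Filter F) : F --> y ->
    cvgc F (fun z : R => (z%:C)%C) (y%:C)%C.
  by move=> Fy; exact: cvgc_real.
pose F y := proot N (1 - kval (zetaK K M ^ j) * ((y ^+ e)%:C)%C).
pose G y := (\prod_(i < e)
  proot (f * N) (1 - kval (zetaK K (e * M) ^ (j + (i * M)%N%:Z)) * (y%:C)%C)) ^+ f.
rewrite -[LHS]/(F x) -[RHS]/(G x).
apply: (@root_lift_eq _ N x F G N0) => [||y yx|y yx||].
- apply/subspace_continuousP => y; rewrite /= in_itv /= => yx; apply/cvgcP.
  apply: cvgc_kummer_root; first by rewrite Re_kummer_gt0 ?lt1e.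
  have -> : (fun t : R => ((t ^+ e)%:C)%C) = (fun t => ((t%:C)%C) ^+ e).
    by apply/funext => t; rewrite rmorphXn.
  rewrite rmorphXn.
  by apply: cvgc_exp; apply: realc; exact: cvg_within.
- apply/subspace_continuousP => y; rewrite /= in_itv /= => yx; apply/cvgcP.
  apply: cvgc_exp; apply: cvgc_prod => i.
  apply: cvgc_kummer_root; first by rewrite Re_kummer_gt0 ?lt1.
  by apply: realc; exact: cvg_within.
- rewrite /F prootK ?Re_kummer_gt0 ?lt1e // /G -exprM -prodrXl.
  rewrite (eq_bigr (fun i : 'I_e => 1 - kv (zetaK K (e * M) ^ (j + (i * M)%N%:Z)) * (y%:C)%C)).
    by rewrite prod_kummer // rmorphXn.
  by move=> i _; rewrite prootK ?Re_kummer_gt0 ?lt1.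
- rewrite /G expf_neq0 //; apply/prodf_neq0 => i _.
  by rewrite proot_neq0 // Re_kummer_gt0 ?lt1.
- rewrite /F /G expr0n gtn_eqF //= mulr0 subr0 proot1 big1 ?expr1n // => i _.
  by rewrite mulr0 subr0 proot1.
- by rewrite x0 lexx.
Qed.

End Roots.

(** * Morphisms between Kummer covers *)

Section Morphisms.
Variables (R : realType) (K : divringClosed R[i]).
Local Notation Kb := (Kbar K).
Local Notation kv := (val : {rmorphism Kb -> R[i]}).

Let inv1X (D : comNzRingType) (a : D) k :
  (exists d, d * a = 1) -> exists d, d * a ^+ k = 1.
Proof. by move=> [c ca]; exists (c ^+ k); rewrite -exprMn ca expr1n. Qed.

Let inv1_prod (D : comNzRingType) k (a : 'I_k -> D) :
  (forall i, exists d, d * a i = 1) -> exists d, d * \prod_i a i = 1.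
Proof.
by move=> /choice[f fP]; exists (\prod_i f i); rewrite -big_split big1 => //= i _; exact: fP.
Qed.

(** Two cases are needed: e = f = l relates consecutive levels of the tower over one V_n, and e = n,
    f = 1 lifts z |-> z^n from V_n to V_1. *)
Lemma pow_morphism e f n N n' N' (n0 : (0 < n)%N) (N0 : (0 < N)%N) (n0' : (0 < n')%N)
    (N0' : (0 < N')%N) : (n * N = e * (n' * N'))%N -> N = (f * N')%N ->
  exists phi : {lrmorphism kummer_alg K n0' N0' -> kummer_alg K n0 N0},
    phi (kx K n0' N0') = kx K n0 N0 ^+ e /\
    forall j, phi (ky K n0' N0' j) =
      (\prod_(i < e) ky K n0 N0 (j + (i * (n' * N'))%N%:Z)) ^+ f.
Proof.
move=> eM eN; have M0' : (0 < n' * N')%N by rewrite muln_gt0 n0'.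
have e0 : (0 < e)%N.
  by move: (muln_gt0 n N); rewrite n0 N0 eM muln_gt0 => /andP[].
have [hp hr hi] := kummer_alg_data K n0 N0.
have [xU yU] := kummer_units n0 N0 (kummer_alg_data K n0 N0).
pose v j := (\prod_(i < e) ky K n0 N0 (j + (i * (n' * N'))%N%:Z)) ^+ f.
have [u' uP] : exists u', kummer_data n' N' (in_alg (kummer_alg K n0 N0)) (kx K n0 N0 ^+ e) v u'.
  apply: kummer_data_units => // [i j ij|j||j].
  - have /eq_modzP[q iE] := ij.
    rewrite /v iE; congr (_ ^+ f).
    (* Moving j by q n'N' translates the index of the product by q modulo e, which permutes the
       factors. *)
    pose h (k : int) := ky K n0 N0 (j + k * (n' * N')%N%:Z).
    rewrite [RHS](eq_bigr (fun k : 'I_e => h (k : nat))); last first.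
      by move=> k _; rewrite /h PoszM.
    rewrite -(@big_affine _ _ _ e 1 1 q h e0) // => [|a b ab].
      by apply: eq_bigr => k _; rewrite /h PoszM; congr (ky _ _ _ _); ring.
    have /eq_modzP[c ->] := ab; apply: hp; apply/eq_modzP; exists c.
    by rewrite eM [in RHS]PoszM; ring.
  - rewrite /v -exprM -eN -prodrXl -(prod_kummer _ _ _ e0 M0').
    by apply: eq_bigr => i _; rewrite hr eM.
  - exact: inv1X.
  - by apply: inv1X; apply: inv1_prod.
by have [phi [px py]] := @kummer_lift R K n' N' n0' N0' (kummer_alg K n0 N0) _ _ u' uP; exists phi.
Qed.

(** Lifts z |-> zeta_n^s z: x goes to w^s x, and zeta_N^j w^s = w^(nj + s) dictates the image of
    y_j. *)
Lemma shift_morphism n N (n0 : (0 < n)%N) (N0 : (0 < N)%N) (s : nat) :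
  exists phi : {lrmorphism kummer_alg K (ltn0Sn 0) N0 -> kummer_alg K n0 N0},
    phi (kx K (ltn0Sn 0) N0) = zetaK K (n * N) ^+ s *: kx K n0 N0 /\
    forall j, phi (ky K (ltn0Sn 0) N0 j) = ky K n0 N0 (n%:Z * j + s%:Z).
Proof.
have M0 : (0 < n * N)%N by rewrite muln_gt0 n0.
have [hp hr hi] := kummer_alg_data K n0 N0.
have [xU yU] := kummer_units n0 N0 (kummer_alg_data K n0 N0).
pose v (j : int) := ky K n0 N0 (n%:Z * j + s%:Z).
have [u' uP] : exists u', kummer_data 1 N (in_alg (kummer_alg K n0 N0))
    (zetaK K (n * N) ^+ s *: kx K n0 N0) v u'.
  apply: kummer_data_units => // [i j ij|j||j].
  - have /eq_modzP[c ->] := ij; apply: hp; apply/eq_modzP; exists c.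
    by rewrite mul1n PoszM; ring.
  - rewrite /v hr /= !mulr_algl scalerA; congr (1 - _ *: _).
    rewrite mul1n; apply: (etrans (zetaK_exprz K _ _ M0)); congr (_ * _).
    exact: zetaK_mulz.
  - have [d dx] := xU; exists ((zetaK K (n * N) ^+ s)^-1 *: d).
    rewrite -scalerAl -scalerAr dx scalerA mulVf ?scale1r // expf_neq0 //.
    exact: (unity_neq0 (zetaK_prim K M0)).
  - exact: yU.
have [phi [px py]] := @kummer_lift R K 1 N (ltn0Sn 0) N0 (kummer_alg K n0 N0) _ _ u' uP.
by exists phi.
Qed.

End Morphisms.

(** * Transport of the standard sections along paths *)

Section Transport.
Import numFieldNormedType.Exports.
Local Open Scope classical_set_scope.
Variables (R : realType) (K : divringClosed R[i]) (l : nat).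
Local Notation Kb := (Kbar K).
Local Notation kv := (val : {rmorphism Kb -> R[i]}).
Local Notation idK := (idfun : {rmorphism Kb -> Kb}).

Lemma norm_expi (x : R) : `|expi x| = 1.
Proof. by rewrite normc_def /= cos2Dsin2 sqrtr1. Qed.

Lemma cvgc_expi (T : Type) (F : set_system T) {FF : Filter F} (f : T -> R) (a : R) :
  f @ F --> a -> cvgc F (fun x => expi (f x)) (expi a).
Proof.
move=> fa; split=> /=; apply: continuous_cvg => //.
  exact: continuous_cos.
exact: continuous_sin.
Qed.

Lemma kval_exprz N (j : int) : kval (zetaK K N ^ j) = zeta R N ^ j.
Proof. exact: (fmorphXz kv). Qed.

Lemma real_root_pow d e N N' (r : R) : (0 < N)%N -> (0 < N')%N -> (e * N' = N * d)%N ->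
  0 < r -> real_root N' (r ^+ d) = real_root N r ^+ e.
Proof.
move=> N0 N0' eNd r0; apply/eqP.
rewrite -(@eqrXn2 _ N') ?exprn_ge0 ?powR_ge0 // real_rootK ?exprn_gt0 //.
by rewrite -exprM eNd exprM real_rootK.
Qed.

Section Standard.
Variables (n N : nat) (n0 : (0 < n)%N) (N0 : (0 < N)%N) (lN : l.-nat N).
Local Notation C := (kummer_cover K n0 N0 lN).

Definition is_standard (y : fibre (Tangential K 1) C) := forall r, 0 < r < 1 ->
  sect y r (kx K n0 N0) = ((real_root N r)%:C)%C /\
  forall j, sect y r (ky K n0 N0 j) = standard_y K n N r j.

Lemma sect_hom u (y : fibre (Tangential K u) C) r : 0 < r < 1 -> hom_over kv (sect y r).
Proof. by move=> r01; have [h _ _] := svalP y; have [] := h r; rewrite ?mem01. Qed.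

Lemma eval_hom z (x : fibre (Point z) C) : hom_over idK (eval_at x).
Proof. by have [h1 h2 _] := svalP x; split. Qed.

Lemma eval_kx z (x : fibre (Point z) C) : eval_at x (kx K n0 N0) ^+ N = z.
Proof. by have [_ _ h3] := svalP x; rewrite -(hom_overX (eval_hom x)). Qed.

Lemma lrmorph_comp_hom (D : comNzRingType) (g : {rmorphism Kb -> D}) (A A' : comAlgType Kb)
    (f : A -> D) (phi : {lrmorphism A' -> A}) : hom_over g f -> hom_over g (f \o phi).
Proof.
move=> [fl [f1 fM]]; split; first by move=> a u v; rewrite /= linearP fl.
by split=> [|u v] /=; rewrite ?rmorph1 // rmorphM fM.
Qed.

End Standard.

(** By [proot_pow], the morphism of [pow_morphism] carries the standard section to the standard
    section; compatibility of the two paths then gives the values at the end points. *)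
Lemma pow_transport n N n' N' (n0 : (0 < n)%N) (N0 : (0 < N)%N) (lN : l.-nat N)
    (n0' : (0 < n')%N) (N0' : (0 < N')%N) (lN' : l.-nat N') d e f z z'
    (gamma : etale_path l n (Tangential K 1) (Point z))
    (gamma' : etale_path l n' (Tangential K 1) (Point z'))
    (y : fibre (Tangential K 1) (kummer_cover K n0 N0 lN))
    (y' : fibre (Tangential K 1) (kummer_cover K n0' N0' lN')) :
    (n * N = e * (n' * N'))%N -> N = (f * N')%N -> (e * N' = N * d)%N ->
    image_under 1 d gamma gamma' -> is_standard y -> is_standard y' ->
  eval_at (gamma' _ y') (kx K n0' N0') = eval_at (gamma _ y) (kx K n0 N0) ^+ e /\
  forall j, eval_at (gamma' _ y') (ky K n0' N0' j) =
    (\prod_(i < e) eval_at (gamma _ y) (ky K n0 N0 (j + (i * (n' * N'))%N%:Z))) ^+ f.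
Proof.
move=> eM eN eNd im ys ys'.
have M0' : (0 < n' * N')%N by rewrite muln_gt0 n0'.
have e0 : (0 < e)%N by move: (muln_gt0 n N); rewrite n0 N0 eM muln_gt0 => /andP[].
have f0 : (0 < f)%N by move: (N0); rewrite eN muln_gt0 => /andP[].
have d0 : (0 < d)%N by move: (muln_gt0 e N'); rewrite e0 N0' eNd muln_gt0 => /andP[].
have [phi [px py]] := pow_morphism K n0 N0 n0' N0' eM eN.
have phit : phi (kt K n0' N0') = 1 *: kt K n0 N0 ^+ d.
  rewrite scale1r -exprM -eNd exprM -px.
  exact: (hom_overX (lrmorph_hom_over phi)).
have ab : above d (phi : {lrmorphism kummer_cover K n0' N0' lN' -> kummer_cover K n0 N0 lN}) y y'.
  move=> r; rewrite mem01 => r01; have [r0 r1] := andP r01.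
  have rd01 : 0 < r ^+ d < 1 by rewrite exprn_gt0 //= exprn_ilt1 ?ltW // -lt0n.
  have hphi := lrmorph_comp_hom phi (sect_hom y r01).
  have rE : real_root N' (r ^+ d) = real_root N r ^+ e.
    exact: real_root_pow.
  apply: (kummer_hom_uniq (sect_hom y' rd01) hphi) => [|j].
    by rewrite (ys' _ rd01).1 rE /= px (hom_overX (sect_hom y r01)) (ys _ r01).1 rmorphXn.
  rewrite (ys' _ rd01).2 /= py (hom_overX (sect_hom y r01)) (hom_over_prod (sect_hom y r01)).
  rewrite /standard_y rE (proot_pow K j e0 f0 N0' M0' (real_root01 N0 r01)).
  congr (_ ^+ _); apply: eq_bigr => i _.
  by rewrite (ys _ r01).2 /standard_y eM eN.
have E := im _ _ (phi : {lrmorphism kummer_cover K n0' N0' lN' -> kummer_cover K n0 N0 lN})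
  phit y y' ab.
have eh := eval_hom (gamma _ y).
split=> [|j]; first by rewrite -(hom_overX eh) -px; exact: E.
apply: (etrans (E _)); rewrite /= py (hom_overX eh) (hom_over_prod eh).
by [].
Qed.

Section Arc.
Variables (n N : nat) (n0 : (0 < n)%N) (N0 : (0 < N)%N) (lN : l.-nat N) (s : nat).
Local Notation C1 := (kummer_cover K (ltn0Sn 0) N0 lN).
Local Notation u_ := (kval (zetaK K n ^+ s)).
Variables (delta : etale_path l 1 (Tangential K 1) (Tangential K u_)).
Hypothesis deltaP : is_arc (2 * pi * s%:R / n%:R) delta.

Lemma expi_zetaK : expi ((2 * pi * s%:R / n%:R) / N%:R) = kval (zetaK K (n * N) ^+ s).
Proof.
rewrite -[kval _]/(kv _) rmorphXn /= /zeta expiX; congr (expi _).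
rewrite -[RHS]mulr_natr natrM invfM -!mulrA.
by congr (_ * (_ * _)); rewrite [RHS]mulrA [RHS]mulrC.
Qed.

(** Along the arc x is rho e^(i phi / N) with rho < 1, so the radicands of the y_j never leave the
    right half-plane and the y_j remain principal roots. At the end of the arc e^(i phi / N) is
    w^s. *)
Lemma arc_standard (y : fibre (Tangential K 1) C1) (r : R) : is_standard y -> 0 < r < 1 ->
  sect (delta _ y) r (kx K (ltn0Sn 0) N0) =
    kval (zetaK K (n * N) ^+ s) * ((real_root N r)%:C)%C /\
  forall j, sect (delta _ y) r (ky K (ltn0Sn 0) N0 j) =
    proot N (1 - kval (zetaK K (1 * N) ^ j) *
      (kval (zetaK K (n * N) ^+ s) * ((real_root N r)%:C)%C)).
Proof.
move=> ys r01; have [r0 r1] := andP r01.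
have r01' : r \in (`]0, 1[ : set R) by rewrite mem01.
have M0 : (0 < 1 * N)%N by rewrite mul1n.
have [Y [Yh Yc Y0 Yt]] := deltaP y r01'.
set theta := 2 * pi * s%:R / n%:R in Yh Yc Yt *.
have t0 : 0 <= theta by rewrite divr_ge0 // mulr_ge0 // mulr_ge0 // pi_ge0.
have tT : 0 <= theta <= theta by rewrite t0 lexx.
have Yhom phi : 0 <= phi <= theta -> hom_over kv (Y phi).
  by move=> h; have [] := Yh phi; rewrite ?inE /= ?in_itv.
have YtE phi : 0 <= phi <= theta -> Y phi (kt K (ltn0Sn 0) N0) = (r%:C)%C * expi phi.
  by move=> h; have [] := Yh phi; rewrite ?inE /= ?in_itv.
set rho := real_root N r in ys *.
have rho01 : 0 <= rho < 1 by exact: real_root01.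
have expic (A : set R) (phi : R) :
    cvgc (within A (nbhs phi)) (fun x => (rho%:C)%C * expi (x / N%:R))
    ((rho%:C)%C * expi (phi / N%:R)).
  apply: cvgc_mul; first exact: cvgc_cst.
  by apply: cvgc_expi; apply: cvgMl; exact: cvg_within.
have YxE phi : 0 <= phi <= theta -> Y phi (kx K (ltn0Sn 0) N0) = (rho%:C)%C * expi (phi / N%:R).
  apply: (@root_lift_eq R N theta (fun p => Y p (kx K (ltn0Sn 0) N0))
    (fun p => (rho%:C)%C * expi (p / N%:R)) N0 (Yc _) _ _ _ _ phi) => [|x xT|x xT|].
  - apply/subspace_continuousP => x _; apply/cvgcP; exact: expic.
  - rewrite -(hom_overX (Yhom _ xT)) YtE // exprMn -rmorphXn real_rootK // expiX.
    by rewrite -(mulr_natr (_ / _)) divfK // pnatr_eq0 -lt0n.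
  - apply: mulf_neq0; first by rewrite fmorph_eq0 gt_eqF // real_root_gt0.
    by rewrite -normr_eq0 norm_expi oner_eq0.
  - by rewrite Y0 (ys _ r01).1 mul0r /expi cos0 sin0 mulr1.
have YyE j phi : 0 <= phi <= theta -> Y phi (ky K (ltn0Sn 0) N0 j) =
    proot N (1 - kval (zetaK K (1 * N) ^ j) * ((rho%:C)%C * expi (phi / N%:R))).
  have Re0 x : 0 < complex.Re (1 - kval (zetaK K (1 * N) ^ j) * ((rho%:C)%C * expi (x / N%:R))).
    rewrite mulrCA mulrC; apply: Re_one_sub_gt0 => //.
    by rewrite normrM norm_zeta // norm_expi mulr1.
  apply: (@root_lift_eq R N theta (fun p => Y p (ky K (ltn0Sn 0) N0 j))
    (fun p => proot N (1 - kval (zetaK K (1 * N) ^ j) * ((rho%:C)%C * expi (p / N%:R))))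
    N0 (Yc _) _ _ _ _ phi) => [|x xT|x xT|].
  - apply/subspace_continuousP => x _; apply/cvgcP.
    by apply: cvgc_kummer_root; [exact: Re0|exact: expic].
  - rewrite prootK // -YxE //.
    by have [_ -> _] := kummer_hom_data (Yhom _ xT).
  - exact: proot_neq0.
  - by rewrite Y0 (ys _ r01).2 mul0r /expi cos0 sin0 mulr1.
split=> [|j]; first by rewrite -Yt YxE // expi_zetaK mulrC.
by rewrite -Yt YyE // expi_zetaK [_ * (rho%:C)%C]mulrC.
Qed.

(** The section reached at the end of the arc is the one that [shift_morphism] induces from the
    standard section on V_n, so the image path can be compared with [gamma]. *)
Lemma shift_transport (z z' : Kb) (gamma : etale_path l n (Tangential K 1) (Point z))
    (j_gamma : etale_path l 1 (Tangential K u_) (Point z'))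
    (y : fibre (Tangential K 1) (kummer_cover K n0 N0 lN)) (y' : fibre (Tangential K 1) C1) :
    image_under (zetaK K n ^+ s) 1 gamma j_gamma -> is_standard y -> is_standard y' ->
  eval_at (j_gamma _ (delta _ y')) (kx K (ltn0Sn 0) N0) =
    zetaK K (n * N) ^+ s * eval_at (gamma _ y) (kx K n0 N0) /\
  forall j, eval_at (j_gamma _ (delta _ y')) (ky K (ltn0Sn 0) N0 j) =
    eval_at (gamma _ y) (ky K n0 N0 (n%:Z * j + s%:Z)).
Proof.
move=> im ys ys'; have M0 : (0 < n * N)%N by rewrite muln_gt0 n0.
have [phi [px py]] := shift_morphism K n0 N0 s.
have phit : phi (kt K (ltn0Sn 0) N0) = (zetaK K n ^+ s) *: kt K n0 N0 ^+ 1.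
  apply: (etrans (hom_overX (lrmorph_hom_over phi) _ _)).
  apply: (etrans (congr1 (fun b => b ^+ N) px)).
  by rewrite exprZn expr1 exprAC mulnC zetaK_mul.
have ab : above 1 (phi : {lrmorphism C1 -> kummer_cover K n0 N0 lN}) y (delta _ y').
  move=> r; rewrite mem01 expr1 => r01.
  have hphi := lrmorph_comp_hom phi (sect_hom y r01).
  have [ax ay] := arc_standard ys' r01.
  apply: (kummer_hom_uniq (sect_hom (delta _ y') r01) hphi) => [|j].
    by rewrite ax /= px (hom_overZ (sect_hom y r01)) (ys _ r01).1.
  have e0 : zetaK K (1 * N) ^ j * zetaK K (n * N) ^+ s = zetaK K (n * N) ^ (n%:Z * j + s%:Z).
    by rewrite zetaK_exprz // mul1n zetaK_mulz.
  have e1 (a : R[i]) : kval (zetaK K (1 * N) ^ j) * (kval (zetaK K (n * N) ^+ s) * a) =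
      kval (zetaK K (n * N) ^ (n%:Z * j + s%:Z)) * a.
    by rewrite mulrA -e0 [kval (_ * _)](rmorphM kv).
  by rewrite ay e1 /= py (ys _ r01).2.
have E := im _ _ (phi : {lrmorphism C1 -> kummer_cover K n0 N0 lN}) phit _ _ ab.
have eh := eval_hom (gamma _ y).
split=> [|j]; first by rewrite -(hom_overZ eh) -px; exact: E.
by apply: (etrans (E _)); rewrite /= py.
Qed.

End Arc.

Section StandardRoots.
Hypothesis l_prime : prime l.

Lemma lm_gt0 m : (0 < l ^ m)%N. Proof. by rewrite expn_gt0 prime_gt0. Qed.
Lemma lm_nat m : l.-nat (l ^ m)%N. Proof. by rewrite pnatX pnat_id. Qed.

Definition tower n (n0 : (0 < n)%N) m := kummer_cover K n0 (lm_gt0 m) (lm_nat m).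

(** [is_polylog_char] quantifies over systems of roots along the path; this provides one with
    explicit values. *)
Lemma standard_roots w (p : etale_path l 1 (Tangential K 1) (Point w))
    (y : forall m, fibre (Tangential K 1) (tower (ltn0Sn 0) m)) :
    (forall m, is_standard (y m)) ->
  exists rt : roots_along p, forall m,
    w_root rt m = eval_at (p _ (y m)) (kx K (ltn0Sn 0) (lm_gt0 m)) /\
    forall a, one_minus_w_root rt m a = eval_at (p _ (y m)) (ky K (ltn0Sn 0) (lm_gt0 m) a).
Proof.
move=> ys.
have P1 m : exists2 h, t_branch l m h &
    continues p h (eval_at (p _ (y m)) (kx K (ltn0Sn 0) (lm_gt0 m))).
  exists (fun r => ((real_root (l ^ m) r)%:C)%C).
    move=> r; rewrite mem01 => /andP[r0 r1].
    by rewrite ltcR real_root_gt0 // -rmorphXn real_rootK // lm_gt0.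
  exists (tower (ltn0Sn 0) m), (y m), (kx K (ltn0Sn 0) (lm_gt0 m)); split=> // r.
  by rewrite mem01 => /(ys m r)[].
have P2 m a : exists2 g, one_minus_t_branch l m a g &
    continues p g (eval_at (p _ (y m)) (ky K (ltn0Sn 0) (lm_gt0 m) a)).
  exists (fun r => standard_y K 1 (l ^ m) r a); last first.
    exists (tower (ltn0Sn 0) m), (y m), (ky K (ltn0Sn 0) (lm_gt0 m) a); split=> // r.
    by rewrite mem01 => /(ys m r)[_ ->].
  have M0 : (0 < 1 * l ^ m)%N by rewrite mul1n lm_gt0.
  split.
  - exists (fun r => ((real_root (l ^ m) r)%:C)%C).
      move=> r; rewrite mem01 => /andP[r0 r1].
      by rewrite ltcR real_root_gt0 // -rmorphXn real_rootK // lm_gt0.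
    move=> r; rewrite mem01 => r01.
    rewrite /standard_y prootK ?lm_gt0 ?Re_kummer_gt0 ?real_root01 ?lm_gt0 //.
    by rewrite kval_exprz mul1n.
  - move=> r; rewrite mem01 => r01; apply/cvgcP.
    by apply: cvgc_standard_y => //; exact: lm_gt0.
  - apply/cvgcP; rewrite -[X in cvgc _ _ X](proot1 R (l ^ m)) -[X in proot _ X]subr0.
    rewrite -(mulr0 (kval (zetaK K (1 * l ^ m) ^ a))).
    apply: cvgc_kummer_root; first by rewrite mulr0 subr0 /= ltr01.
    apply: (cvgc_real (a := 0)); apply: powR_cvg0.
    by rewrite invr_gt0 ltr0n lm_gt0.
by exists (RootsAlong P1 P2).
Qed.

End StandardRoots.

End Transport.

(** * Galois action and sums over residues *)

Section Reduction.
Variables (l m : nat).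
Hypothesis N_gt1 : (1 < l ^ m)%N.
Local Notation N := (l ^ m)%N.
Local Notation A := ('Z_N).

Lemma intr_Zp_eq (a b : int) : (a%:~R == b%:~R :> A) = (a == b %[mod N%:Z])%Z.
Proof.
rewrite -subr_eq0 -rmorphB eqz_mod_dvd /= dvdzE.
have natE (k : nat) : (k%:R == 0 :> A) = (N %| k)%N.
  by rewrite -val_eqE /= val_Zp_nat // /dvdn.
by case: (a - b) => k /=; rewrite ?NegzE ?rmorphN ?oppr_eq0 natE.
Qed.

Lemma intr_Zp_mod (a : int) : (a %% N%:Z)%Z%:~R = a%:~R :> A.
Proof. by apply/eqP; rewrite intr_Zp_eq modz_mod. Qed.

(** An identity in Z_l is checked in each Z/l^m, where ring identities and the binomial theorem can
    be used. *)
Lemma padic_reduction : exists red : {rmorphism padic_int l -> A},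
  forall x : padic_int l, red x = (x m)%:~R.
Proof.
pose f (x : padic_int l) : A := (x m)%:~R.
have fD x y : f (x + y) = f x + f y.
  by rewrite /f -rmorphD -[RHS]intr_Zp_mod.
have fN x : f (- x) = - f x.
  by rewrite /f -rmorphN -[RHS]intr_Zp_mod.
have fB : zmod_morphism f by move=> x y; rewrite fD fN.
have fM : monoid_morphism f.
  split; first by rewrite /f /= intr_Zp_mod.
  by move=> x y; rewrite /f -rmorphM -[RHS]intr_Zp_mod.
pose fa := GRing.isZmodMorphism.Build (padic_int l) A f fB.
pose fm := GRing.isMonoidMorphism.Build (padic_int l) A f fM.
pose red : {rmorphism padic_int l -> A} := HB.pack f fa fm.
by exists red.
Qed.

Lemma padic_level_eq (x y : padic_int l) : (x m)%:~R = (y m)%:~R :> A -> x m = y m.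
Proof. by move/eqP; rewrite intr_Zp_eq !pres_mod => /eqP. Qed.

End Reduction.

Lemma pinvP (l m : nat) (u : padic_unit l) :
  ((u : padic_int l) m * Defs.pinv u m = 1 %[mod (l ^ m)%N])%Z.
Proof. by case: u => x y /= /(congr1 (fun v : padic_int l => v m)). Qed.

Lemma big_digits (T : Type) (idx : T) (op : Monoid.com_law idx) (n N : nat) (F : nat -> T) :
  \big[op/idx]_(j < n * N) F j = \big[op/idx]_(s < n) \big[op/idx]_(a < N) F (a + s * N)%N.
Proof.
elim: n => [|n IHn]; first by rewrite mul0n !big_ord0.
rewrite mulSnr big_split_ord big_ord_recr /= IHn; congr (op _ _).
by apply: eq_bigr => i _; rewrite addnC.
Qed.

Section GaloisAction.
Variables (R : realType) (K : divringClosed R[i]) (l : nat) (l_prime : prime l).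
Local Notation Kb := (Kbar K).

(** Sigma fixes W_0, so sigma(W_m) / W_m is an l^m-th root of unity; the l-th power relation makes
    the exponents compatible. The Kummer characters are needed to unfold [is_polylog_char]. *)
Lemma kummer_char_exists (W : nat -> Kb) :
    (forall m, W m.+1 ^+ l = W m) -> W 0%N != 0 -> kval (W 0%N) \in K ->
  exists rho : galois_aut K -> padic_int l,
    forall (sigma : galois_aut K) m, sigma (W m) = zetaK K (l ^ m) ^ rho sigma m * W m.
Proof.
move=> Wl W0 WK.
suff h (sigma : galois_aut K) : exists rho : padic_int l,
    forall m, sigma (W m) = zetaK K (l ^ m) ^ rho m * W m.
  by have [rho rhoP] := choice h; exists rho.
have WX m : W m ^+ (l ^ m) = W 0%N.
  by elim: m => [|m IHm]; rewrite ?expn0 ?expr1 // expnS exprM Wl.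
have Wn m : W m != 0.
  by apply: contraNneq W0 => h; rewrite -(WX m) h expr0n gtn_eqF // (lm_gt0 l_prime).
have sp m := zetaK_prim K (lm_gt0 l_prime m).
have /choice[a aP] m : exists i : nat, sigma (W m) = zetaK K (l ^ m) ^+ i * W m.
  have : (sigma (W m) / W m) ^+ (l ^ m) = 1.
    rewrite expr_div_n -rmorphXn WX gal_fix // divff //.
  by move=> /(unity_rootz (sp m))[i _ iE]; exists i; rewrite -iE divfK.
have ac m : ((a m)%:Z = (a m.+1)%:Z %[mod (l ^ m)%:Z])%Z.
  apply/eqP; rewrite -(eq_unity_exprz (sp m)); apply/eqP.
  apply: (mulIf (Wn m)); rewrite -[_ ^ (a m)%:Z]/(_ ^+ a m) -aP -Wl rmorphXn aP exprMn.
  by congr (_ * _); rewrite exprAC expnS (zetaK_mul K (prime_gt0 l_prime) (lm_gt0 l_prime m)).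
exists (padic_of ac) => m; rewrite aP; congr (_ * _).
by rewrite /= unity_exprz_mod.
Qed.

(** The congruence mod n is where the inclusion of mu_n in K enters. Both congruences are kept,
    since n and N need not be coprime. *)
Lemma galois_zeta (n N : nat) (sigma : galois_aut K) (x : int) :
    (0 < n)%N -> (0 < N)%N -> (forall w : R[i], w ^+ n = 1 -> w \in K) ->
    sigma (zetaK K N) = zetaK K N ^ x ->
  exists c : int, [/\ sigma (zetaK K (n * N)) = zetaK K (n * N) ^ c,
    (c = 1 %[mod n%:Z])%Z & (c = x %[mod N%:Z])%Z].
Proof.
move=> n0 N0 mu_n sN; have M0 : (0 < n * N)%N by rewrite muln_gt0 n0.
have Mp := zetaK_prim K M0; have Np := zetaK_prim K N0; have np := zetaK_prim K n0.
have : sigma (zetaK K (n * N)) ^+ (n * N) = 1.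
  by rewrite -rmorphXn (prim_expr_order Mp) rmorph1.
move=> /(unity_rootz Mp)[c _ cE]; exists c%:Z; split=> //.
  apply/eqP; rewrite -(eq_unity_exprz np) expr1z; apply/eqP.
  have nE : zetaK K n = zetaK K (n * N) ^+ N by rewrite mulnC zetaK_mul.
  rewrite -[_ ^ c%:Z]/(_ ^+ c) {1}nE exprAC -cE -rmorphXn -nE gal_fix //.
  by apply: mu_n; exact: zeta_unity.
apply/eqP; rewrite -(eq_unity_exprz Np) -sN; apply/eqP.
rewrite -[_ ^ c%:Z]/(_ ^+ c) -(zetaK_mul K n0 N0) exprAC -cE.
by rewrite rmorphXn.
Qed.

(** After sigma is applied factor by factor, the values of [om] in numerator and denominator cancel;
    equality of the remaining powers of zeta_(l^m) is equality of exponents mod l^m. *)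
Lemma polylog_sum (m : nat) (sigma : galois_aut K) (x nu rho : int) (e : nat)
    (om : int -> Kb) (kap : int -> int) : (0 < m)%N ->
    (forall a, om a != 0) ->
    (forall a : int, sigma (om (nu * a)) = zetaK K (l ^ m) ^ kap a * om (a + rho)) ->
    zetaK K (l ^ m) ^ x = sigma (\prod_(0 <= a < l ^ m) om (nu * a%:Z) ^+ (a ^ e)) /
      \prod_(0 <= a < l ^ m) om (a%:Z + rho) ^+ (a ^ e) ->
  x%:~R = \sum_(a < l ^ m) (kap (a : nat))%:~R * (a : nat)%:R ^+ e :> 'Z_(l ^ m).
Proof.
move=> m0 om0 sE xE; have N1 : (1 < l ^ m)%N by rewrite -(expn0 l) ltn_exp2l ?prime_gt1.
have zp := zetaK_prim K (lm_gt0 l_prime m); have z0 := unity_neq0 zp.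
have : zetaK K (l ^ m) ^ x = zetaK K (l ^ m) ^ (\sum_(a < l ^ m) kap (a : nat) * (a ^ e)%N%:Z).
  rewrite xE !big_mkord rmorph_prod.
  rewrite (eq_bigr (fun a : 'I_(l ^ m) => zetaK K (l ^ m) ^ (kap (a : nat) * (a ^ e)%N%:Z) *
      om ((a : nat)%:Z + rho) ^+ (a ^ e))) => [|a _]; last first.
    by rewrite rmorphXn sE exprMn -exprz_exp.
  rewrite big_split /= mulfK; last by apply/prodf_neq0 => a _; rewrite expf_neq0.
  symmetry; apply: (big_morph (fun i => zetaK K (l ^ m) ^ i)) => // i j.
  by rewrite expfzDr.
move/eqP; rewrite (eq_unity_exprz zp) -(intr_Zp_eq N1) => /eqP ->.
rewrite rmorph_sum; apply: eq_bigr => a _.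
by rewrite rmorphM /= -[((a ^ e)%N%:Z)%:~R]/((a ^ e)%N%:R) natrX.
Qed.

End GaloisAction.

(** * Sums over residues mod nN, grouped in two ways *)

Section Distribution.
Variables (A : comNzRingType) (n N k : nat) (chi nu : int) (kap : int -> A).
Hypotheses (n0 : (0 < n)%N) (N0 : (0 < N)%N).
Hypothesis chi_nu : (chi * nu = 1 %[mod N%:Z])%Z.
Hypothesis intrA : forall a b : int, (a = b %[mod N%:Z])%Z -> a%:~R = b%:~R :> A.
Hypothesis kapP : forall i j, (i = j %[mod (n * N)%N%:Z])%Z -> kap i = kap j.

Let F (j : int) : A := kap j * (chi * j)%:~R ^+ k.

Let FP i j : (i = j %[mod (n * N)%N%:Z])%Z -> F i = F j.
Proof.
move=> ij; rewrite /F (kapP ij); congr (_ * _ ^+ _); apply: intrA.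
have /eq_modzP[q ->] := ij; apply/eq_modzP; exists (chi * q * n%:Z).
by rewrite PoszM; ring.
Qed.

Let chinu_A : chi%:~R * nu%:~R = 1 :> A.
Proof. by have := intrA chi_nu; rewrite intrM => ->. Qed.

Let N_A : N%:R = 0 :> A.
Proof. by rewrite -[N%:R]/(N%:Z%:~R) (@intrA N%:Z 0) // modzz mod0z. Qed.

(* Both sides are the sum of [F] over the residues mod nN. *)
Lemma distribution_sum :
  \sum_(a < N) (\sum_(s < n) kap (nu * (a : nat)%:Z + (s * N)%N%:Z)) * (a : nat)%:R ^+ k =
  \sum_(s < n) \sum_(b < N) kap (n%:Z * (nu * (b : nat)%:Z) + (s : nat)%:Z) *
    ((s : nat)%:R * chi%:~R + n%:R * (b : nat)%:R) ^+ k.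
Proof.
have nu_chi : (nu * chi = 1 %[mod N%:Z])%Z by rewrite mulrC.
pose G (x : int) := \sum_(s < n) F (x + (s * N)%N%:Z).
pose H (s : nat) (x : int) := F (n%:Z * x + s%:Z).
(* For j = nu a + sN one has chi j = a mod N, so the weight in [F] is a^k. *)
transitivity (\sum_(a < N) G (nu * (a : nat)%:Z + 0)).
  apply: eq_bigr => a _; rewrite mulr_suml; apply: eq_bigr => s _.
  rewrite /F addr0; congr (_ * _ ^+ _).
  rewrite mulrDr rmorphD mulrA !rmorphM /= chinu_A mul1r.
  by rewrite -[N%:~R]/(N%:R) N_A !mulr0 addr0.
rewrite (@big_affine _ _ _ N nu chi 0 G) //; last first.
  move=> i j /eq_modzP[q ->]; rewrite /G.
  pose h (x : int) := F (j + x * N%:Z).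
  rewrite [RHS](eq_bigr (fun s : 'I_n => h (s : nat))); last by move=> s _; rewrite /h PoszM.
  rewrite -(@big_affine _ _ _ n 1 1 q h) // => [|a b /eq_modzP[c ->]].
    by apply: eq_bigr => s _; rewrite /h PoszM; congr F; ring.
  by apply: FP; apply/eq_modzP; exists c; rewrite PoszM; ring.
(* For j = n nu b + s one has chi j = s chi + n b mod N. *)
transitivity (\sum_(s < n) \sum_(b < N) H s (nu * (b : nat)%:Z + 0)); last first.
  apply: eq_bigr => s _; apply: eq_bigr => b _; rewrite /H /F addr0.
  congr (_ * _ ^+ _).
  have -> : chi * (n%:Z * (nu * (b : nat)%:Z) + (s : nat)%:Z) =
    (s : nat)%:Z * chi + n%:Z * ((chi * nu) * (b : nat)%:Z) by ring.
  by rewrite rmorphD !rmorphM /= chinu_A mul1r.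
transitivity (\sum_(s < n) \sum_(b < N) H s (b : nat)); last first.
  apply: eq_bigr => s _; rewrite (@big_affine _ _ _ N nu chi 0 (H s)) //.
  move=> i j /eq_modzP[q ->]; apply: FP; apply/eq_modzP; exists q.
  by rewrite PoszM; ring.
(* The residues mod nN are enumerated once as a + sN and once as nb + s. *)
rewrite exchange_big [RHS]exchange_big /=.
rewrite (eq_bigr (fun s : 'I_n => \sum_(a < N) F (a + s * N)%N)) //.
rewrite -(big_digits _ n N (fun j => F j)).
rewrite mulnC (big_digits _ N n (fun j => F j)).
by apply: eq_bigr => b _; apply: eq_bigr => s _; rewrite /H addrC PoszD PoszM mulrC.
Qed.

End Distribution.

(** * Galois action on the transported roots *)

Section GaloisShift.
Variables (R : realType) (K : divringClosed R[i]) (sigma : galois_aut K).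
Local Notation Kb := (Kbar K).
Variables (n N : nat) (n0 : (0 < n)%N) (N0 : (0 < N)%N) (X : Kb) (Y : int -> Kb) (u' : Kb).
Local Notation M := (n * N)%N.
Hypothesis XY : kummer_data n N (idfun : {rmorphism Kb -> Kb}) X Y u'.
Variables (c r : int).
Hypothesis sigma_zeta : sigma (zetaK K M) = zetaK K M ^ c.
Hypothesis sigmaX : sigma X = zetaK K N ^ r * X.

Let M0 : (0 < M)%N. Proof. by rewrite muln_gt0 n0. Qed.

Lemma kummer_neq0 : X != 0 /\ forall j, Y j != 0.
Proof.
have [[d dX] dY] := kummer_units n0 N0 XY.
split=> [|j]; first by apply: contra_eq_neq dX => ->; rewrite mulr0 eq_sym oner_eq0.
by have [e eY] := dY j; apply: contra_eq_neq eY => ->; rewrite mulr0 eq_sym oner_eq0.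
Qed.

(* sigma maps 1 - w^j X to 1 - w^(c j + n r) X. *)
Lemma galois_shift : exists kap : int -> int,
  (forall j, sigma (Y j) = zetaK K N ^ kap j * Y (c * j + n%:Z * r)) /\
  (forall i j, (i = j %[mod M%:Z])%Z -> (kap i = kap j %[mod N%:Z])%Z).
Proof.
have [hp hr hi] := XY; have [X0 Y0] := kummer_neq0.
have Np := zetaK_prim K N0.
have /choice[kap kapE] j : exists k : int, sigma (Y j) = zetaK K N ^ k * Y (c * j + n%:Z * r).
  have : (sigma (Y j) / Y (c * j + n%:Z * r)) ^+ N = 1.
    rewrite expr_div_n -rmorphXn !hr /=.
    have -> : sigma (1 - zetaK K M ^ j * X) = 1 - zetaK K M ^ (c * j + n%:Z * r) * X.
      rewrite rmorphB rmorph1 rmorphM fmorphXz sigma_zeta sigmaX exprz_exp mulrA.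
      by rewrite zetaK_exprz // zetaK_mulz.
    apply: divff; apply: contra_neq (expf_neq0 N (Y0 (c * j + n%:Z * r))) => h.
    by rewrite hr -h.
  by move=> /(unity_rootz Np)[k _ kE]; exists k%:Z; rewrite -[_ ^ k%:Z]/(_ ^+ k) -kE divfK.
exists kap; split=> // i j ij; apply/eqP; rewrite -(eq_unity_exprz Np); apply/eqP.
apply: (mulIf (Y0 (c * i + n%:Z * r))); rewrite -kapE (hp _ _ ij) kapE; congr (_ * _).
apply: hp; have /eq_modzP[q ->] := ij; apply/eq_modzP; exists (- (c * q)).
by ring.
Qed.

Variables (kap : int -> int) (nu : int).
Hypothesis kapE : forall j, sigma (Y j) = zetaK K N ^ kap j * Y (c * j + n%:Z * r).
Hypothesis c_nu : (c * nu = 1 %[mod N%:Z])%Z.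

Lemma galois_prod (rho a : int) : (c = 1 %[mod n%:Z])%Z -> (rho = n%:Z * r %[mod N%:Z])%Z ->
  sigma (\prod_(s < n) Y (nu * a + (s * N)%N%:Z)) =
  zetaK K N ^ (\sum_(s < n) kap (nu * a + (s * N)%N%:Z)) *
    \prod_(s < n) Y (a + rho + (s * N)%N%:Z).
Proof.
have [hp hr hi] := XY.
move=> /eq_modzP[q cE] /eq_modzP[p rhoE]; have /eq_modzP[t tE] := c_nu.
rewrite rmorph_prod (eq_bigr _ (fun s _ => kapE _)) big_split /=; congr (_ * _).
  symmetry; apply: (big_morph (fun i => zetaK K N ^ i)) => // i j.
  exact: zetaK_exprz.
pose h (x : int) := Y (a + rho + x * N%:Z).
rewrite [RHS](eq_bigr (fun s : 'I_n => h (s : nat))); last by move=> s _; rewrite /h PoszM.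
(* As c = 1 mod n, sigma only translates s: c (nu a + sN) + n r = a + rho + (s + t a - p) N mod
   nN. *)
rewrite -(@big_affine _ _ _ n 1 1 (t * a - p) h) // => [|i j /eq_modzP[e ->]].
  apply: eq_bigr => s _; rewrite /h PoszM; apply: hp; apply/eq_modzP; exists (q * (s : nat)%:Z).
  have -> : c * (nu * a + (s : nat)%:Z * N%:Z) + n%:Z * r =
    (c * nu) * a + c * ((s : nat)%:Z * N%:Z) + n%:Z * r by ring.
  by rewrite tE cE rhoE PoszM; ring.
by apply: hp; apply/eq_modzP; exists e; rewrite PoszM; ring.
Qed.

(** Sigma sends index j to c j + n r. Since c nu = 1 mod N, the part n nu b becomes n b mod nN, and
    the hypothesis accounts for the rest; it expresses that [rho] is the Kummer exponent of w^s
    X. *)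
Lemma galois_residue (s : nat) (rho b : int) :
    (c * s%:Z + n%:Z * r = s%:Z + n%:Z * rho %[mod M%:Z])%Z ->
  sigma (Y (n%:Z * (nu * b) + s%:Z)) =
    zetaK K N ^ kap (n%:Z * (nu * b) + s%:Z) * Y (n%:Z * (b + rho) + s%:Z).
Proof.
have [hp hr hi] := XY; move=> /eq_modzP[p pE]; have /eq_modzP[t tE] := c_nu.
rewrite kapE; congr (_ * _); apply: hp; apply/eq_modzP; exists (t * b + p).
have -> : c * (n%:Z * (nu * b) + s%:Z) + n%:Z * r =
  n%:Z * ((c * nu) * b) + (c * s%:Z + n%:Z * r) by ring.
by rewrite tE pE PoszM; ring.
Qed.

End GaloisShift.

(** * The distribution relation modulo every power of l *)

Theorem theorem5p1 (R : realType) (K : divringClosed R[i])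
    (l : nat) (l_prime : prime l)
    (n : nat) (n_gt0 : (0 < n)%N)
    (mu_n_sub : forall x : R[i], x ^+ n = 1 -> x \in K)
    (z : Kbar K) (zK : kval z \in K) (z_neq0 : z != 0) (zn_neq1 : z ^+ n != 1)
    (gamma : etale_path l n (Tangential K 1) (Point z))
    (pi_gamma : etale_path l 1 (Tangential K 1) (Point (z ^+ n)))
    (pi_gammaP : image_under 1 n gamma pi_gamma)
    (delta : forall s : 'I_n,
       etale_path l 1 (Tangential K 1) (Tangential K (kval (zetaK K n ^+ s))))
    (deltaP : forall s : 'I_n, is_arc (2 * pi * s%:R / n%:R) (delta s))
    (j_gamma : forall s : 'I_n,
       etale_path l 1 (Tangential K (kval (zetaK K n ^+ s)))
                (Point (zetaK K n ^+ s * z)))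
    (j_gammaP : forall s : 'I_n, image_under (zetaK K n ^+ s) 1 gamma (j_gamma s))
    (chi : galois_aut K -> padic_unit l) (chiP : is_cyclotomic_char chi)
    (chi_zn : nat -> galois_aut K -> padic_int l)
    (chi_znP : forall k, (1 <= k)%N -> is_polylog_char chi k pi_gamma (chi_zn k))
    (chi_z : 'I_n -> nat -> galois_aut K -> padic_int l)
    (chi_zP : forall (s : 'I_n) d, (1 <= d)%N ->
       is_polylog_char chi d (path_comp (delta s) (j_gamma s)) (chi_z s d)) :
  forall (k : nat) (sigma : galois_aut K), (1 <= k)%N ->
    chi_zn k sigma =
    \sum_(1 <= d < k.+1)
      'C(k.-1, d.-1)%:R * n%:R ^+ (d.-1) *
      \sum_(s < n) (s%:R * (chi sigma : padic_int l)) ^+ (k - d) * chi_z s d sigma.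
Proof.
move=> k sigma k_gt0.
have std n' (n0' : (0 < n')%N) m :
    {y : fibre (Tangential K 1) (tower K l_prime n0' m) | is_standard y}.
  by apply: cid; exact: standard_fibre.
pose y m := projT1 (std n n_gt0 m); have ys m : is_standard (y m) := projT2 (std n n_gt0 m).
pose y1 m := projT1 (std 1%N (ltn0Sn 0) m).
have ys1 m : is_standard (y1 m) := projT2 (std 1%N (ltn0Sn 0) m).
pose x m := eval_at (gamma _ (y m)).
pose X m : Kbar K := x m (kx K n_gt0 (lm_gt0 l_prime m)).
pose Y m (j : int) : Kbar K := x m (ky K n_gt0 (lm_gt0 l_prime m) j).
have xh m : hom_over (idfun : {rmorphism Kbar K -> Kbar K}) (x m) := eval_hom _.
have lN := lm_gt0 l_prime; have l0 := prime_gt0 l_prime.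
have zn_K : kval (zetaK K n) \in K by apply: mu_n_sub; exact: zeta_unity.
(* At level 0 the root has order l^0 = 1, so x is t itself. *)
have X0 : X 0%N = z by rewrite -[LHS]expr1; exact: eval_kx.
have Xl m : X m.+1 ^+ l = X m.
  have eM : (n * l ^ m.+1 = l * (n * l ^ m))%N by rewrite expnS mulnCA.
  have eN : (l * l ^ m = l ^ m.+1 * 1)%N by rewrite muln1 expnS.
  have [E _] := pow_transport eM (expnS l m) eN (transport_natural gamma) (ys m.+1) (ys m).
  exact: esym E.
have piE m : eval_at (pi_gamma _ (y1 m)) (kx K (ltn0Sn 0) (lN m)) = X m ^+ n /\
    forall a, eval_at (pi_gamma _ (y1 m)) (ky K (ltn0Sn 0) (lN m) a) =
      \prod_(s < n) Y m (a + (s * l ^ m)%N%:Z).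
  have eM : (n * l ^ m = n * (1 * l ^ m))%N by rewrite mul1n.
  have eN : (l ^ m = 1 * l ^ m)%N by rewrite mul1n.
  have [E pE] := pow_transport eM eN (mulnC _ _) pi_gammaP (ys m) (ys1 m).
  split=> [|a]; first exact: E.
  apply: (etrans (pE a)); rewrite expr1; apply: eq_bigr => s _.
  by rewrite mul1n.
have jE (s : 'I_n) m : eval_at (j_gamma s _ (delta s _ (y1 m))) (kx K (ltn0Sn 0) (lN m)) =
      zetaK K (n * l ^ m) ^+ s * X m /\
    forall a, eval_at (j_gamma s _ (delta s _ (y1 m))) (ky K (ltn0Sn 0) (lN m) a) =
      Y m (n%:Z * a + (s : nat)%:Z).
  exact: (shift_transport (deltaP s) (j_gammaP s) (ys m) (ys1 m)).
have [rt_pi rt_piE] := standard_roots pi_gamma ys1.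
have rt_ex (s : 'I_n) := standard_roots (path_comp (delta s) (j_gamma s)) ys1.
(* Kummer characters for z, z^n and the zeta_n^s z: each system of roots starts at a nonzero element
   of K. *)
have [rhoX rhoXE] : exists rho : galois_aut K -> padic_int l,
    forall (tau : galois_aut K) m, tau (X m) = zetaK K (l ^ m) ^ rho tau m * X m.
  by apply: kummer_char_exists => //; rewrite X0.
have [rho_pi rho_piE] : exists rho : galois_aut K -> padic_int l,
    forall (tau : galois_aut K) m, tau (X m ^+ n) = zetaK K (l ^ m) ^ rho tau m * X m ^+ n.
  apply: (kummer_char_exists l_prime (W := fun m => X m ^+ n)) => [m||].
  - by rewrite exprAC Xl.
  - by rewrite X0 expf_neq0.
  - by rewrite X0 -[kval _]/(val _) rmorphXn rpredX.
have /choice[rho_j rho_jE] (s : 'I_n) : exists rho : galois_aut K -> padic_int l,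
    forall (tau : galois_aut K) m, tau (zetaK K (n * l ^ m) ^+ s * X m) =
      zetaK K (l ^ m) ^ rho tau m * (zetaK K (n * l ^ m) ^+ s * X m).
  apply: (kummer_char_exists l_prime (W := fun m => zetaK K (n * l ^ m) ^+ s * X m)) => [m||].
  - rewrite exprMn Xl exprAC expnS mulnCA zetaK_mul // muln_gt0 n_gt0; exact: lN.
  - by rewrite X0 expn0 muln1 mulf_neq0 ?expf_neq0 ?(unity_neq0 (zetaK_prim K n_gt0)).
  - rewrite X0 expn0 muln1 -[kval _]/(val _) rmorphM rmorphXn.
    exact: (rpredM (rpredX s zn_K) zK).
(* Level 0 is arithmetic mod 1 and is settled apart, since ['Z_N] is Z/N only for N > 1. *)
apply: padic_eqP => -[|m].
  by rewrite -[LHS]pres_mod -[RHS]pres_mod expn0 !modz1.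
set N := (l ^ m.+1)%N; have N0 : (0 < N)%N := lN m.+1.
have N1 : (1 < N)%N by rewrite /N -(expn0 l) ltn_exp2l ?prime_gt1.
apply: (padic_level_eq N1); have [red redE] := padic_reduction N1.
have Np := zetaK_prim K N0; have M0 : (0 < n * N)%N by rewrite muln_gt0 n_gt0.
have Mp := zetaK_prim K M0.
have [c [cE c_n c_N]] := galois_zeta n_gt0 N0 mu_n_sub (chiP sigma m.+1).
set nu := Defs.pinv (chi sigma) m.+1.
have chi_nu : ((chi sigma : padic_int l) m.+1 * nu = 1 %[mod N%:Z])%Z := pinvP _ _.
have c_nu : (c * nu = 1 %[mod N%:Z])%Z by rewrite -modzMml c_N modzMml.
have XY := kummer_hom_data (xh m.+1).
have [X_neq0 Y_neq0] := kummer_neq0 n_gt0 N0 XY.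
have [kap [kapE kapP]] := galois_shift n_gt0 N0 XY cE (rhoXE sigma m.+1).
have rho_pi_mod : (rho_pi sigma m.+1 = n%:Z * rhoX sigma m.+1 %[mod N%:Z])%Z.
  apply/eqP; rewrite -(eq_unity_exprz Np); apply/eqP.
  apply: (mulIf (expf_neq0 n X_neq0)); rewrite -[RHS]/(_ * X m.+1 ^+ n) -[LHS]rho_piE.
  by rewrite rmorphXn rhoXE exprMn [n%:Z * _]mulrC -exprz_exp.
(* The two sides are the exponents of w by which sigma multiplies X in w^s X, computed factor by
   factor and through [rho_j]. *)
have rho_j_mod (s : 'I_n) : (c * (s : nat)%:Z + n%:Z * rhoX sigma m.+1 =
    (s : nat)%:Z + n%:Z * rho_j s sigma m.+1 %[mod (n * N)%N%:Z])%Z.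
  apply/eqP; rewrite -(eq_unity_exprz Mp); apply/eqP; apply: (mulIf X_neq0).
  have := rho_jE s sigma m.+1; rewrite rmorphM rmorphXn cE rhoXE !zetaK_exprz // !zetaK_mulz //.
  rewrite -[(_ ^ c) ^+ s]/((_ ^ c) ^ (s : nat)%:Z) exprz_exp mulrA => ->.
  by rewrite mulrA [_ * zetaK K (n * N) ^+ s]mulrC.
have zn_sum := @polylog_sum R K l l_prime m.+1 sigma (chi_zn k sigma m.+1) nu
  (rho_pi sigma m.+1) k.-1
  (fun a => \prod_(s < n) Y m.+1 (a + (s * N)%N%:Z))
  (fun a => \sum_(s < n) kap (nu * a + (s * N)%N%:Z)) isT.
have kum_pi : is_kummer_char rt_pi rho_pi.
  by move=> tau i; rewrite (rt_piE i).1 (piE i).1 rho_piE.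
rewrite {}zn_sum; first last.
- rewrite (chi_znP k k_gt0 rt_pi rho_pi kum_pi sigma m.+1 isT).
  by congr (sigma _ / _); apply: eq_bigr => a _; rewrite (rt_piE _).2 (piE _).2.
- by move=> a; exact: (galois_prod n_gt0 N0 XY kapE c_nu).
- by move=> a; apply/prodf_neq0 => s _; exact: Y_neq0.
have z_sum (s : 'I_n) d : (1 <= d)%N -> red (chi_z s d sigma) =
    \sum_(b < N) (kap (n%:Z * (nu * (b : nat)%:Z) + (s : nat)%:Z))%:~R * (b : nat)%:R ^+ d.-1.
  move=> d0; have [rt rtE] := rt_ex s.
  have kum : is_kummer_char rt (rho_j s).
    move=> tau i; rewrite (rtE i).1 -[eval_at _ _]/(eval_at (j_gamma s _ (delta s _ (y1 i))) _).
    by rewrite (jE s i).1 rho_jE.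
  rewrite redE; apply: (@polylog_sum R K l l_prime m.+1 sigma (chi_z s d sigma m.+1) nu
    (rho_j s sigma m.+1) d.-1 (fun a => Y m.+1 (n%:Z * a + (s : nat)%:Z))
    (fun b => kap (n%:Z * (nu * b) + (s : nat)%:Z)) isT) => [a|a|].
  - exact: Y_neq0.
  - exact: (galois_residue XY kapE c_nu).
  - rewrite (chi_zP s d d0 rt (rho_j s) kum sigma m.+1 isT).
    congr (sigma _ / _); apply: eq_bigr => a _; rewrite (rtE _).2; congr (_ ^+ _);
      exact: (jE s m.+1).2.
rewrite -redE rmorph_sum big_add1 /= big_mkord.
rewrite (eq_bigr (fun a : 'I_N => (\sum_(s < n) (kap (nu * (a : nat)%:Z + (s * N)%N%:Z))%:~R) *
    (a : nat)%:R ^+ k.-1)); last by move=> a _; rewrite rmorph_sum.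
rewrite (@distribution_sum 'Z_N n N k.-1 ((chi sigma : padic_int l) m.+1) nu
  (fun j => (kap j)%:~R)) //; first last.
- by move=> i j /kapP ij; apply/eqP; rewrite intr_Zp_eq //; apply/eqP.
- by move=> a b ab; apply/eqP; rewrite intr_Zp_eq //; apply/eqP.
(* The index d now starts at 0 and stands for d - 1 of the statement, so k is written as a successor
   for the exponents k - d to simplify. *)
rewrite -(prednK k_gt0) /=.
under [RHS]eq_bigr => d _.
  rewrite rmorphM rmorphM rmorphXn !rmorph_nat rmorph_sum mulr_sumr.
  under eq_bigr => s _ do
    rewrite rmorphM rmorphXn rmorphM rmorph_nat redE z_sum // mulr_sumr mulr_sumr.
  over.
rewrite [RHS]exchange_big /=; apply: eq_bigr => s _.
rewrite [RHS]exchange_big /=; apply: eq_bigr => b _.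
(* For fixed s and b, the sum over d is the binomial expansion of (s chi + n b)^(k-1). *)
rewrite exprDn mulr_sumr; apply: eq_bigr => d _.
have ac (a1 a2 a3 a4 a5 : 'Z_N) : a1 * (a2 * (a3 * a4) * a5) = a5 * a3 * (a2 * (a1 * a4)) by ring.
by rewrite subSS [(n%:R * _) ^+ d]exprMn -[_ *+ 'C(_, _)]mulr_natr; exact: ac.
Qed.
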